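(* Let $a,c\in\mathbb{C}$ and $\beta:=\frac{a+c-1}{2}$, with $c,\beta\notin\{0,-1,-2,\dots\}$. Then the following hold as operators on $C^\omega$: (i) with $y=\frac{4x}{(1+x)^2}$, $$(1+x)^{2\beta}\,\mathcal{H}_c^a(x)\,(1+x)^{-2\beta}=\mathcal{H}_c^{\beta}(y)\,(1-y)^{-\frac{c-a}{2}}\,\mathcal{H}_{\beta}^{a}(y);$$ (ii) with $y=4x(1-x)$, $$(1-x)^{1-c}\,\mathcal{H}_c^a(x)\,(1-x)^{a-1}=\mathcal{H}_c^{\beta}(y)\,(1-y)^{-\frac{c-a}{2}}\,\mathcal{H}_{\beta}^{a}(y);$$ (iii) with $y=\frac{4x(x-1)}{(1-2x)^2}$, $$(1-x)^{1-c}\,\mathcal{H}_c^a(x)\,(1-x)^{a-1}=(1-y)^{\beta}\,\mathcal{H}_c^{\beta}(y)\,(1-y)^{-\frac{c-a}{2}}\,\mathcal{H}_{\beta}^{a}(y)\,(1-y)^{-\beta}.$$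
   Context: $C^\omega$ is the space of (germs of) functions analytic near $0\in\mathbb{C}$. $(q)_n=q(q+1)\cdots(q+n-1)$, $(q)_0=1$. For $a,c\in\mathbb{C}$ with $c\notin\{0,-1,-2,\dots\}$ the hypergeometrization is the linear operator $\mathcal{H}_c^a:C^\omega\to C^\omega$, $\mathcal{H}_c^a\left(\sum_n f_nx^n\right)=\sum_n f_n\frac{(a)_n}{(c)_n}x^n$; it is also denoted $\mathcal{H}_c^a(x)$. If $y=y(x)$ is analytic near $0$ with $y(0)=0$, $y'(0)\neq0$, then every $f\in C^\omega$ is uniquely $f=g\circ y$ with $g\in C^\omega$, and $\mathcal{H}_c^a(y)f:=(\mathcal{H}_c^a g)\circ y$. A function $h\in C^\omega$ written in an operator expression denotes multiplication by $h$, and juxtaposition denotes composition. Complex powers of functions equal to $1$ at $0$ are the branches with value $1$ at $0$. *)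

(* Defs.v *)
(* Stdlib reals with Coquelicot's complex numbers. *)
From Stdlib Require Export Reals ClassicalEpsilon Program.Basics.
From Coquelicot Require Export Coquelicot.

Open Scope program_scope.
Open Scope C_scope.

(** A germ at 0 is represented by any function [C -> C] that induces it;
    two representatives are identified by [germ_eq]. *)
Definition near0 (P : C -> Prop) : Prop := locally (T := C_UniformSpace) (RtoC 0) P.

Definition germ_eq (f g : C -> C) : Prop := near0 (fun x => f x = g x).

Definition has_expansion (f : C -> C) (u : nat -> C) : Prop :=
  near0 (fun x => is_pseries (K := C_AbsRing) (V := C_NormedModule) u x (f x)).

Definition analytic0 (f : C -> C) : Prop := exists u, has_expansion f u.

(** The Taylor coefficients at 0 of an analytic germ (arbitrary otherwise). *)
Definition coef (f : C -> C) : nat -> C :=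
  epsilon (inhabits (fun _ => RtoC 0)) (has_expansion f).

(** The sum of a convergent power series (arbitrary where it diverges). *)
Definition psum (u : nat -> C) (x : C) : C :=
  epsilon (inhabits (RtoC 0))
    (fun l : C => is_pseries (K := C_AbsRing) (V := C_NormedModule) u x l).

Fixpoint poch (q : C) (n : nat) : C :=
  match n with
  | O => 1
  | S m => poch q m * (q + INR m)
  end.

Definition nonpos_int (z : C) : Prop := exists n : nat, z = - RtoC (INR n).

Definition Cexp (z : C) : C :=
  ((exp (Re z) * cos (Im z))%R, (exp (Re z) * sin (Im z))%R).

(** Principal argument and logarithm off the closed negative real axis; the
    argument is given by the half-angle formula. *)
Definition Carg (z : C) : R := (2 * atan (Im z / (Cmod z + Re z)))%R.

Definition Clog (z : C) : C := (ln (Cmod z), Carg z).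

(** The principal branch of z^s.  It is analytic near z = 1 with value 1 there,
    so for h analytic at 0 with h(0) = 1 the germ of [fun x => cpower (h x) s]
    is the branch of h^s with value 1 at 0. *)
Definition cpower (z s : C) : C := Cexp (s * Clog z).

Definition operator : Type := (C -> C) -> (C -> C).

Definition mul (h : C -> C) : operator := fun f x => h x * f x.

Definition op_eq (A B : operator) : Prop :=
  forall f, analytic0 f -> germ_eq (A f) (B f).

(** The hypergeometrization with respect to the coordinate x. *)
Definition hyper (a c : C) : operator :=
  fun f => psum (fun n => coef f n * (poch a n / poch c n)).

(** For y analytic near 0 with y(0) = 0 and y'(0) <> 0, the germ g such that
    f = g o y, which exists and is unique when f is analytic. *)
Definition pullback (y f : C -> C) : C -> C :=
  epsilon (inhabits (fun _ => RtoC 0))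
    (fun g => analytic0 g /\ germ_eq f (g ∘ y)).

(** The hypergeometrization with respect to the coordinate y (meaningful for y
    as in [pullback]). *)
Definition hyper_in (a c : C) (y : C -> C) : operator :=
  fun f => hyper a c (pullback y f) ∘ y.

(* Main.v *)
Require Import Defs.
From Stdlib Require Import Lra Lia FunctionalExtensionality.

(** Write theta for [x d/dx], put [e = a + c], so that
    [2 beta = e - 1], and let [T_p = 2 theta (theta + e - 1) - x (theta + p) (2 theta + e)],
    the hypergeometric operator with numerator parameters [p] and [e / 2]
    ([gauss e p] below).  The hypergeometrization is diagonal on monomials, hence
    commutes with theta, and it satisfies [H_c^a x (theta + c) = x (theta + a) H_c^a].
    Three consequences:
    - in the coordinate [y], the composite
      [R = H_c^beta (1-y)^((a-c)/2) H_beta^a] commutes with [T_beta]: the first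
      factor turns [T_beta] into [T_a], the power of [1 - y] turns [T_a] into [T_c]
      (Euler's transformation), and the last factor turns [T_c] back into [T_beta]
      ([bridge_gauss]);
    - pulled back along each quadratic substitution and conjugated by the powers
      that stand to the right of [H_c^a(x)], the operator [T_beta] becomes a
      polynomial in theta and [x (theta + c)] ([koebe_intertwines],
      [logistic_intertwines], [pfaff_intertwines]);
    - [H_c^a] carries such a polynomial to the same polynomial in theta and
      [x (theta + a)], which is the operator obtained from [T_beta] with the
      powers on the left.
    So the difference of the two sides, as an operator on power series, intertwines
    two operators that are triangular for the order of vanishing with the same
    eigenvalues [2 n (n + 2 beta)]; and it raises the order of vanishing, because
    both sides multiply the leading coefficient by the same number.  When the
    eigenvalues are distinct such an operator is zero ([commuting_zero]).  They
    collide only if [2 beta] is a negative integer.  Each Taylor coefficient of either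
    side is a rational function of the parameters, so that case follows by moving [c]
    to [c + eps] and letting [eps] tend to 0 ([intertwining_all_parameters]).

    The passage from germs to their Taylor coefficients rests on the expansion of
    products and compositions, both of them instances of one statement on double
    series ([double_series]); on the binomial series for the principal power, proved
    by integrating the differential equation of [(1 - k x)^s] along rays
    ([expansion_cpower]); and on explicit inverses of the three substitutions, all
    rational in [(1 - y)^(1/2)], which show that every analytic germ is a function
    of [y] ([coordinate_of_inverse]). *)

Set Bullet Behavior "Strict Subproofs".

(** * The ring of formal power series *)

(** A notation rather than a constant: series built by fixpoints and by lambdas
    then all have syntactically the same type, which the [ring] tactic needs. *)
Notation fps := (nat -> C).
Implicit Types u v w y : fps.

Definition tl (u : fps) : fps := fun n => u (S n).

(** The Cauchy product, by recursion on the degree.  In this form every ring law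
    is a plain induction, with no manipulation of finite sums. *)
Fixpoint fmul (u v : fps) (n : nat) : C :=
  match n with
  | O => u O * v O
  | S m => u O * v (S m) + fmul (tl u) v m
  end.
Definition fadd (u v : fps) : fps := fun n => u n + v n.
Definition fopp (u : fps) : fps := fun n => - u n.
Definition fsub (u v : fps) : fps := fun n => u n - v n.
Definition cst (c : C) : fps := fun n => match n with O => c | S _ => 0 end.
Definition X : fps := fun n => match n with S O => 1 | _ => 0 end.

Arguments cst c%_C.
Declare Scope fps_scope.
Delimit Scope fps_scope with fps.

Infix "+" := fadd : fps_scope.
Infix "-" := fsub : fps_scope.
Infix "*" := fmul : fps_scope.
Notation "- u" := (fopp u) : fps_scope.

Ltac Cring := match goal with |- ?l = ?r => change (@eq C l r) end; ring.

Lemma RtoC_neq (x y : R) : x <> y -> RtoC x <> RtoC y.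
Proof. intros H E. apply H. now apply RtoC_inj. Qed.

Lemma fps_ext (u v : fps) : (forall n, u n = v n) -> u = v.
Proof. apply functional_extensionality. Qed.

Lemma fmul_S_r u v n : fmul u v (S n) = fmul u (tl v) n + u (S n) * v O.
Proof.
  revert u; induction n as [|n IH]; intros u; [reflexivity|].
  change (fmul u v (S (S n))) with (u O * v (S (S n)) + fmul (tl u) v (S n)).
  rewrite IH. simpl. unfold tl. ring.
Qed.

Lemma fmul_comm u v : fmul u v = fmul v u.
Proof.
  apply fps_ext; intros n; revert u v; induction n as [|n IH]; intros u v.
  - simpl. ring.
  - rewrite fmul_S_r. simpl. rewrite (IH u (tl v)). ring.
Qed.

Lemma fmul_add_l u v w : fmul (fadd u v) w = fadd (fmul u w) (fmul v w).
Proof.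
  apply fps_ext; intros n; revert u v; induction n as [|n IH]; intros u v.
  - unfold fadd; simpl. ring.
  - simpl. change (tl (fadd u v)) with (fadd (tl u) (tl v)).
    rewrite IH. unfold fadd; simpl. ring.
Qed.

Lemma fmul_scal_l k u v n : fmul (fun m => k * u m) v n = k * fmul u v n.
Proof.
  revert u; induction n as [|n IH]; intros u; simpl; [ring|].
  change (tl (fun m => k * u m)) with (fun m => k * tl u m).
  rewrite IH. ring.
Qed.

Lemma fmul_assoc u v w : fmul u (fmul v w) = fmul (fmul u v) w.
Proof.
  apply fps_ext; intros n; revert u; induction n as [|n IH]; intros u.
  - simpl. ring.
  - change (fmul (fmul u v) w (S n))
      with (u O * v O * w (S n) + fmul (fadd (fun m => u O * tl v m) (fmul (tl u) v)) w n).
    rewrite fmul_add_l. unfold fadd at 1. rewrite fmul_scal_l, <- IH. simpl. ring.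
Qed.

Lemma fmul_zero_l u n : fmul (fun _ => 0) u n = 0.
Proof. induction n as [|n IH]; simpl; [ring|]. change (tl (fun _ => RtoC 0)) with (fun _ : nat => RtoC 0). rewrite IH. ring. Qed.

Lemma fmul_cst k u n : fmul (cst k) u n = k * u n.
Proof.
  destruct n; simpl; [reflexivity|].
  change (tl (cst k)) with (fun _ : nat => RtoC 0). rewrite fmul_zero_l. ring.
Qed.

Lemma fmul_X_S u n : fmul X u (S n) = u n.
Proof.
  change (0 * u (S n) + fmul (tl X) u n = u n).
  replace (tl X) with (cst 1) by (apply fps_ext; intros [|m]; reflexivity).
  rewrite fmul_cst. ring.
Qed.

Lemma fmul_X_0 u : fmul X u O = 0.
Proof. simpl. ring. Qed.

Lemma fps_ring_theory : ring_theory (cst 0) (cst 1) fadd fmul fsub fopp (@eq fps).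
Proof.
  split; intros.
  - apply fps_ext; intros [|n]; unfold fadd; simpl; ring.
  - apply fps_ext; intros n; unfold fadd; ring.
  - apply fps_ext; intros n; unfold fadd; ring.
  - apply fps_ext; intros n; rewrite fmul_cst; ring.
  - apply fmul_comm.
  - apply fmul_assoc.
  - apply fmul_add_l.
  - apply fps_ext; intros n; unfold fsub, fadd, fopp; ring.
  - apply fps_ext; intros [|n]; unfold fadd, fopp; simpl; ring.
Qed.
Add Ring fps_ring : fps_ring_theory.

Definition euler (u : fps) : fps := fun n => RtoC (INR n) * u n.

Lemma RtoC_INR_S n : RtoC (INR (S n)) = RtoC (INR n) + 1.
Proof. rewrite S_INR, RtoC_plus. reflexivity. Qed.

Lemma euler_add u v : euler (u + v)%fps = (euler u + euler v)%fps.
Proof. apply fps_ext; intros n; unfold euler, fadd. ring. Qed.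

Lemma euler_sub u v : euler (u - v)%fps = (euler u - euler v)%fps.
Proof. apply fps_ext; intros n; unfold euler, fsub. ring. Qed.

Lemma euler_opp u : euler (- u)%fps = (- euler u)%fps.
Proof. apply fps_ext; intros n; unfold euler, fopp. ring. Qed.

Lemma euler_cst k : euler (cst k) = cst 0.
Proof. apply fps_ext; intros [|n]; unfold euler; simpl; ring. Qed.

Lemma euler_X : euler X = X.
Proof. apply fps_ext; intros [|[|n]]; unfold euler; simpl; ring. Qed.

Lemma euler_mul u v : euler (u * v)%fps = (euler u * v + u * euler v)%fps.
Proof.
  apply fps_ext; intros n; revert u; induction n as [|n IH]; intros u.
  - unfold euler, fadd; simpl. ring.
  - change (RtoC (INR (S n)) * (u O * v (S n) + fmul (tl u) v n) =
      (RtoC (INR O) * u O * v (S n) + fmul (tl (euler u)) v n)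
      + (u O * (RtoC (INR (S n)) * v (S n)) + fmul (tl u) (euler v) n)).
    replace (tl (euler u)) with (fadd (euler (tl u)) (tl u)).
    2:{ apply fps_ext; intros m. unfold fadd, euler, tl. rewrite RtoC_INR_S. ring. }
    rewrite fmul_add_l. unfold fadd at 1.
    specialize (IH (tl u)). unfold fadd, euler at 1 in IH.
    rewrite RtoC_INR_S. simpl INR.
    transitivity ((INR n + 1) * (u O * v (S n)) + INR n * fmul (tl u) v n + fmul (tl u) v n); [ring|].
    rewrite IH. ring.
Qed.

Lemma cst_add k l : cst (k + l) = (cst k + cst l)%fps.
Proof. apply fps_ext; intros [|n]; unfold fadd; simpl; ring. Qed.
Lemma cst_opp k : cst (- k) = (- cst k)%fps.
Proof. apply fps_ext; intros [|n]; unfold fopp; simpl; ring. Qed.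
Lemma cst_sub k l : cst (k - l) = (cst k - cst l)%fps.
Proof. apply fps_ext; intros [|n]; unfold fsub; simpl; ring. Qed.
Lemma cst_mul k l : cst (k * l) = (cst k * cst l)%fps.
Proof. apply fps_ext; intros n. rewrite fmul_cst. destruct n; simpl; ring. Qed.

(** * Complex powers as formal series *)

(** The Taylor coefficients of [(1 - k x)^s].  The recursion is the differential
    equation of this function, see [pw_euler]. *)
Fixpoint pw (k s : C) (n : nat) : C :=
  match n with
  | O => 1
  | S m => pw k s m * (k * (INR m - s) / INR (S m))
  end.

Lemma INR_S_neq_0 n : RtoC (INR (S n)) <> 0.
Proof. intros H. apply (not_0_INR (S n)); [lia|]. now apply RtoC_inj. Qed.

Definition one_sub (k : C) : fps := (cst 1 - cst k * X)%fps.

Lemma one_sub_mul_0 k u : fmul (one_sub k) u O = u O.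
Proof. unfold one_sub, fsub; simpl. ring. Qed.
Lemma one_sub_mul_S k u n : fmul (one_sub k) u (S n) = u (S n) - k * u n.
Proof.
  unfold one_sub. replace (fmul (cst 1 - cst k * X)%fps u) with (u - cst k * (X * u))%fps by ring.
  unfold fsub. now rewrite fmul_cst, fmul_X_S.
Qed.

Lemma pw_euler k s :
  (one_sub k * euler (pw k s))%fps = (- (cst (s * k) * (X * pw k s)))%fps.
Proof.
  apply fps_ext; intros [|n].
  - rewrite one_sub_mul_0. unfold euler, fopp. rewrite fmul_cst, fmul_X_0. simpl. ring.
  - rewrite one_sub_mul_S. unfold euler, fopp. rewrite fmul_cst, fmul_X_S.
    change (pw k s (S n)) with (pw k s n * (k * (INR n - s) / INR (S n))).
    field. apply INR_S_neq_0.
Qed.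

(** The differential equation determines each coefficient from the previous one,
    so identities between powers reduce to checking it ([pw_add], [pw_1], [pw_0]). *)
Lemma pw_unique k s u :
  u O = RtoC 1 -> (one_sub k * euler u)%fps = (- (cst (s * k) * (X * u)))%fps -> u = pw k s.
Proof.
  intros H0 H. apply fps_ext; intros n; induction n as [|n IH]; [exact H0|].
  pose proof (f_equal (fun w : fps => w (S n)) H) as E. cbv beta in E.
  rewrite one_sub_mul_S in E. unfold euler, fopp in E. rewrite fmul_cst, fmul_X_S in E.
  change (u (S n) = pw k s n * (k * (INR n - s) / INR (S n))).
  rewrite <- IH.
  apply (f_equal (fun z => (z + k * (INR n * u n)) / INR (S n))) in E.
  transitivity ((INR (S n) * u (S n) - k * (INR n * u n) + k * (INR n * u n)) / INR (S n)).
  - field. apply INR_S_neq_0.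
  - rewrite E. field. apply INR_S_neq_0.
Qed.

(** The inverse of [1 - k x].  Rational coefficients are written as polynomials in
    [X] and [geom k], so that identities between them can be left to [ring] modulo
    [geom_X]. *)
Definition geom (k : C) : fps := pw k (- (1)).

Lemma one_sub_geom k : (one_sub k * geom k)%fps = cst 1.
Proof.
  apply fps_ext; intros [|n].
  - rewrite one_sub_mul_0. reflexivity.
  - rewrite one_sub_mul_S. unfold geom.
    change (pw k (- (1)) (S n)) with (pw k (- (1)) n * (k * (INR n - - (1)) / INR (S n))).
    pose proof (INR_S_neq_0 n) as H. rewrite RtoC_INR_S in *. simpl. field. exact H.
Qed.

Lemma euler_pw k s : euler (pw k s) = (- (cst s * ((geom k - cst 1) * pw k s)))%fps.
Proof.
  transitivity (geom k * (one_sub k * euler (pw k s)))%fps.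
  - replace (geom k * (one_sub k * euler (pw k s)))%fps
      with ((one_sub k * geom k) * euler (pw k s))%fps by ring.
    rewrite one_sub_geom. ring.
  - rewrite pw_euler, cst_mul.
    assert (E : (cst k * X * geom k)%fps = (geom k - cst 1)%fps).
    { rewrite <- (one_sub_geom k). unfold one_sub. ring. }
    rewrite <- E. ring.
Qed.

Lemma pw_add k s t : (pw k s * pw k t)%fps = pw k (s + t).
Proof.
  apply pw_unique; [simpl; ring|].
  rewrite euler_mul.
  transitivity ((one_sub k * euler (pw k s)) * pw k t + pw k s * (one_sub k * euler (pw k t)))%fps; [ring|].
  rewrite !pw_euler. rewrite !cst_mul, cst_add. ring.
Qed.

Lemma pw_1 k : pw k 1 = one_sub k.
Proof.
  symmetry. apply pw_unique.
  - unfold one_sub, fsub. simpl. ring.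
  - unfold one_sub. rewrite euler_sub, euler_mul, !euler_cst, euler_X, cst_mul. ring.
Qed.

Lemma pw_0 k : pw k 0 = cst 1.
Proof.
  symmetry. apply pw_unique; [reflexivity|].
  rewrite euler_cst, cst_mul. ring.
Qed.

(** * Substitution of one series into another *)

Fixpoint fpow (y : fps) (k : nat) : fps :=
  match k with O => cst 1 | S j => fmul y (fpow y j) end.

(** Substitution of [y] into [g]; the sum may stop at [n] because [y 0 = 0]. *)
Definition comp (y g : fps) : fps := fun n => sum_n (fun k => g k * fpow y k n) n.
Definition below (n : nat) (u : fps) : Prop := forall k, (k < n)%nat -> u k = 0.

Lemma fmul_below m n u v : below m u -> below n v ->
  below (m + n) (fmul u v) /\ fmul u v (m + n)%nat = u m * v n.
Proof.
  revert u; induction m as [|m IH]; intros u Hu Hv.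
  - assert (H : forall j w, (forall k, (k <= j)%nat -> v k = 0) -> fmul w v j = 0).
    { induction j as [|j IHj]; intros w Hw; simpl; rewrite Hw by lia; [ring|].
      rewrite IHj by (intros; apply Hw; lia). ring. }
    split.
    + intros k Hk. apply H. intros; apply Hv; lia.
    + destruct n as [|n]; [reflexivity|]. simpl. rewrite H by (intros; apply Hv; lia). ring.
  - assert (E : forall k, fmul u v (S k) = fmul (tl u) v k).
    { intros k. simpl. rewrite (Hu O) by lia. ring. }
    destruct (IH (tl u)) as [H1 H2]; [intros k Hk; apply Hu; lia|exact Hv|].
    split.
    + intros [|k] Hk; [simpl; rewrite (Hu O) by lia; ring|]. rewrite E. apply H1; lia.
    + change (S m + n)%nat with (S (m + n)). rewrite E. exact H2.
Qed.

Lemma fpow_below y : y O = 0 -> forall k, below k (fpow y k) /\ fpow y k k = Cpow (y 1%nat) k.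
Proof.
  intros Hy k; induction k as [|k [IH1 IH2]]; [split; [intros j Hj; lia|reflexivity]|].
  assert (Hy1 : below 1 y) by (intros [|j] Hj; [exact Hy|lia]).
  destruct (fmul_below 1 k y (fpow y k) Hy1 IH1) as [H1 H2].
  split; [exact H1|]. rewrite IH2 in H2. exact H2.
Qed.

Lemma sum_n_C_S (f : nat -> C) n : sum_n f (S n) = sum_n f n + f (S n).
Proof. apply (sum_Sn f n). Qed.

Lemma sum_n_C_0 (f : nat -> C) : sum_n f 0 = f O.
Proof. apply (sum_O f). Qed.

Lemma sum_n_C_scal (k : C) (f : nat -> C) n :
  k * sum_n f n = sum_n (fun j => k * f j) n.
Proof.
  induction n as [|n IH]; [now rewrite !sum_n_C_0|].
  rewrite !sum_n_C_S, <- IH. Cring.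
Qed.

Lemma sum_n_C_zero (f : nat -> C) n :
  (forall k, (k <= n)%nat -> f k = 0) -> @eq C (sum_n f n) 0.
Proof.
  intros H; induction n as [|n IH]; [rewrite sum_n_C_0; now apply H|].
  rewrite sum_n_C_S, H, IH by (intros; try apply H; lia). Cring.
Qed.

Lemma comp_extend y (g : fps) n N : y O = 0 -> (n <= N)%nat ->
  comp y g n = sum_n (fun k => g k * fpow y k n) N.
Proof.
  intros Hy H; induction H as [|N H IH]; [reflexivity|].
  rewrite sum_n_C_S, <- IH. rewrite (proj1 (fpow_below y Hy (S N)) n) by lia. ring.
Qed.

Lemma fmul_sum (A : nat -> fps) w N n :
  fmul w (fun m => sum_n (fun k => A k m) N) n = sum_n (fun k => fmul w (A k) n) N.
Proof.
  induction N as [|N IH].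
  - rewrite sum_n_C_0. f_equal. apply fps_ext; intros m; apply sum_n_C_0.
  - rewrite sum_n_C_S, <- IH.
    replace (fun m => sum_n (fun k => A k m) (S N))
      with (fadd (fun m => sum_n (fun k => A k m) N) (A (S N)))
      by (apply fps_ext; intros m; unfold fadd; now rewrite sum_n_C_S).
    rewrite fmul_comm, fmul_add_l. unfold fadd. now rewrite (fmul_comm _ w), (fmul_comm (A (S N)) w).
Qed.

Lemma fmul_ext_le w u v n : (forall k, (k <= n)%nat -> u k = v k) -> fmul w u n = fmul w v n.
Proof.
  revert w; induction n as [|n IH]; intros w H; simpl; rewrite H by lia; [reflexivity|].
  f_equal. apply IH. intros; apply H; lia.
Qed.

(** The form in which products and derivatives of a substitution are computed
    termwise: all the identities below hold for the powers of [y]. *)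
Lemma mul_comp y (g w : fps) n : y O = 0 ->
  fmul w (comp y g) n = sum_n (fun k => g k * fmul w (fpow y k) n) n.
Proof.
  intros Hy.
  transitivity (fmul w (fun m => sum_n (fun k => fmul (cst (g k)) (fpow y k) m) n) n).
  - apply fmul_ext_le. intros m Hm. rewrite (comp_extend y g m n Hy Hm).
    apply sum_n_ext. intros k. now rewrite fmul_cst.
  - rewrite fmul_sum. apply sum_n_ext; intros k.
    change (fmul w (fmul (cst (g k)) (fpow y k)) n = g k * fmul w (fpow y k) n).
    replace (fmul w (fmul (cst (g k)) (fpow y k))) with (fmul (cst (g k)) (fmul w (fpow y k))) by ring.
    now rewrite fmul_cst.
Qed.

Lemma comp_add y (g h : fps) : comp y (g + h)%fps = (comp y g + comp y h)%fps.
Proof.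
  apply fps_ext; intros n; unfold comp, fadd. rewrite <- (sum_n_plus (G := C_AbelianGroup)).
  apply sum_n_ext; intros k. change (((g k + h k) * fpow y k n = g k * fpow y k n + h k * fpow y k n)). ring.
Qed.

Lemma comp_cst_mul y k (g : fps) : comp y (cst k * g)%fps = (cst k * comp y g)%fps.
Proof.
  apply fps_ext; intros n. rewrite fmul_cst. unfold comp. rewrite sum_n_C_scal.
  apply sum_n_ext; intros j. rewrite fmul_cst. Cring.
Qed.

Lemma comp_sub y (g h : fps) : comp y (g - h)%fps = (comp y g - comp y h)%fps.
Proof.
  replace (g - h)%fps with (g + cst (- (1)) * h)%fps by (rewrite cst_opp; ring).
  rewrite comp_add, comp_cst_mul, cst_opp. ring.
Qed.

Lemma sum_n_C_shift (f : nat -> C) n : sum_n f (S n) = f O + sum_n (fun k => f (S k)) n.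
Proof.
  induction n as [|n IH]; [now rewrite sum_n_C_S, !sum_n_C_0|].
  rewrite sum_n_C_S, IH, sum_n_C_S. Cring.
Qed.

Lemma comp_X_mul y (g : fps) : y O = 0 -> comp y (X * g)%fps = (y * comp y g)%fps.
Proof.
  intros Hy; apply fps_ext; intros n.
  rewrite mul_comp by exact Hy.
  rewrite (comp_extend y (X * g)%fps n (S n) Hy) by lia.
  rewrite sum_n_C_shift, fmul_X_0.
  rewrite (sum_n_ext _ (fun k => g k * fmul y (fpow y k) n)).
  - ring.
  - intros k. now rewrite fmul_X_S.
Qed.

Lemma euler_fpow y (q : fps) : euler y = (q * y)%fps ->
  forall k, euler (fpow y k) = (cst (INR k) * (q * fpow y k))%fps.
Proof.
  intros H k; induction k as [|k IH].
  - simpl. rewrite euler_cst. ring.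
  - simpl fpow. rewrite euler_mul, IH, H, RtoC_INR_S, cst_add. ring.
Qed.

(** The chain rule.  With [q] the logarithmic derivative [theta y / y] no division
    is needed. *)
Lemma euler_comp y (q : fps) : y O = 0 -> euler y = (q * y)%fps ->
  forall g, euler (comp y g) = (q * comp y (euler g))%fps.
Proof.
  intros Hy H g; apply fps_ext; intros n. rewrite mul_comp by exact Hy.
  transitivity (RtoC (INR n) * comp y g n); [reflexivity|].
  unfold comp. rewrite sum_n_C_scal. apply sum_n_ext; intros k.
  pose proof (f_equal (fun w : fps => w n) (euler_fpow y q H k)) as E. cbv beta in E.
  rewrite fmul_cst in E. unfold euler in E.
  change (INR n * (g k * fpow y k n) = INR k * g k * fmul q (fpow y k) n).
  transitivity (g k * (INR n * fpow y k n)); [ring|]. rewrite E. ring.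
Qed.

Lemma comp_below y n (g : fps) : y O = 0 -> below n g ->
  below n (comp y g) /\ comp y g n = g n * Cpow (y 1%nat) n.
Proof.
  intros Hy Hg. split.
  - intros m Hm. apply sum_n_C_zero. intros k Hk. rewrite Hg by lia. ring.
  - unfold comp. destruct n as [|n].
    + rewrite sum_n_C_0. simpl. ring.
    + rewrite sum_n_C_S, sum_n_C_zero.
      * rewrite (proj2 (fpow_below y Hy (S n))). Cring.
      * intros k Hk. rewrite Hg by lia. ring.
Qed.

(** Substitution multiplies the leading coefficient by a power of [y 1]. *)
Lemma comp_inj y (g h : fps) : y O = 0 -> y 1%nat <> 0 -> comp y g = comp y h -> g = h.
Proof.
  intros Hy Hy1 E.
  assert (E' : comp y (g - h)%fps = cst 0) by (rewrite comp_sub, E; ring).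
  assert (H : forall n, below n (g - h)%fps).
  { induction n as [|n IH]; [intros k Hk; lia|].
    intros k Hk. destruct (Nat.eq_dec k n) as [->|Hne]; [|apply IH; lia].
    destruct (comp_below y n _ Hy IH) as [_ H2]. rewrite E' in H2.
    destruct (Ceq_dec ((g - h)%fps n) 0) as [H0|H0]; [exact H0|exfalso].
    apply (Cmult_neq_0 _ _ H0 (Cpow_nz _ n Hy1)). rewrite <- H2. now destruct n. }
  apply fps_ext; intros n. specialize (H (S n) n (Nat.lt_succ_diag_r n)).
  unfold fsub in H. transitivity (g n - h n + h n); [ring|]. rewrite H. ring.
Qed.

(** * Hypergeometrization and second-order operators *)

Definition hyp (a c : C) (u : fps) : fps := fun n => u n * (poch a n / poch c n).

Lemma poch_neq_0 c n : ~ nonpos_int c -> poch c n <> 0.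
Proof.
  intros Hc. induction n as [|n IH]; [apply RtoC_neq; lra|].
  simpl. apply Cmult_neq_0; [exact IH|]. intros H. apply Hc. exists n.
  transitivity (c + INR n - INR n); [ring|]. rewrite H. ring.
Qed.

(** The operator [x (theta + c)], through which a change of the parameters of the
    hypergeometrization is seen, see [hyp_raise]. *)
Definition raise (c : C) (u : fps) : fps := (X * (euler u + cst c * u))%fps.

Lemma hyp_add a c u v : hyp a c (u + v)%fps = (hyp a c u + hyp a c v)%fps.
Proof. apply fps_ext; intros n; unfold hyp, fadd; ring. Qed.
Lemma hyp_sub a c u v : hyp a c (u - v)%fps = (hyp a c u - hyp a c v)%fps.
Proof. apply fps_ext; intros n; unfold hyp, fsub; ring. Qed.
Lemma hyp_cst_mul a c k u : hyp a c (cst k * u)%fps = (cst k * hyp a c u)%fps.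
Proof. apply fps_ext; intros n; unfold hyp; rewrite !fmul_cst; ring. Qed.
Lemma hyp_euler a c u : hyp a c (euler u) = euler (hyp a c u).
Proof. apply fps_ext; intros n; unfold hyp, euler; ring. Qed.

Lemma hyp_raise a c u : ~ nonpos_int c -> hyp a c (raise c u) = raise a (hyp a c u).
Proof.
  intros Hc. apply fps_ext; intros n. unfold raise, hyp at 1.
  destruct n as [|n]; [rewrite !fmul_X_0; ring|].
  rewrite !fmul_X_S. unfold fadd. rewrite !fmul_cst. unfold euler, hyp.
  pose proof (poch_neq_0 c (S n) Hc) as H.
  simpl poch in H |- *. field. split; intros E; apply H; rewrite E; ring.
Qed.

(** Twice the hypergeometric operator with lower parameter [e] and upper parameters
    [p] and [e / 2]; doubling keeps the coefficients integral in [e] and [p]. *)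
Definition gauss (e p : C) (u : fps) : fps :=
  (cst 2 * euler (euler u + cst (e - 1) * u) - raise p (cst 2 * euler u + cst e * u))%fps.

(** The pull-back of [gauss] along [4 x (1 - x)], conjugated by a power of [1 - x]. *)
Definition quad (e p : C) (u : fps) : fps :=
  (cst 2 * euler (euler u + cst (e - 1) * u) - cst 2 * raise p (cst 2 * euler u + cst e * u)
   + cst 2 * raise p (raise p u))%fps.

Lemma hyp_gauss a c e u : ~ nonpos_int c -> hyp a c (gauss e c u) = gauss e a (hyp a c u).
Proof.
  intros Hc. unfold gauss.
  rewrite hyp_sub, hyp_raise by exact Hc.
  now rewrite !hyp_cst_mul, hyp_euler, !hyp_add, !hyp_cst_mul, hyp_euler.
Qed.

Lemma hyp_quad a c e u : ~ nonpos_int c -> hyp a c (quad e c u) = quad e a (hyp a c u).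
Proof.
  intros Hc. unfold quad.
  rewrite hyp_add, hyp_sub, !hyp_cst_mul, !hyp_raise by exact Hc.
  now rewrite hyp_euler, !hyp_add, !hyp_cst_mul, hyp_euler.
Qed.

Lemma cst_2 : cst 2 = (cst 1 + cst 1)%fps.
Proof. rewrite <- cst_add. f_equal. ring. Qed.

Lemma geom_X k : (cst k * X * geom k)%fps = (geom k - cst 1)%fps.
Proof. rewrite <- (one_sub_geom k). unfold one_sub. ring. Qed.

Lemma euler_geom k : euler (geom k) = ((geom k - cst 1) * geom k)%fps.
Proof.
  unfold geom at 1. rewrite euler_pw, cst_opp. fold (geom k). ring.
Qed.

Ltac push_euler :=
  repeat (progress rewrite ?euler_add, ?euler_sub, ?euler_opp, ?euler_mul, ?euler_cst, ?euler_X,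
     ?euler_geom, ?euler_pw).

(** Euler's transformation as an identity of operators: the parameters [a] and
    [e / 2] of the first operator become [e - a = c] and [e / 2]. *)
Lemma gauss_mul_pw a c g :
  gauss (a + c) c (pw 1 ((a - c) / 2) * g)%fps = (pw 1 ((a - c) / 2) * gauss (a + c) a g)%fps.
Proof.
  set (b := (a - c) / 2).
  (* All parameters in terms of [a] and [b], to avoid halves. *)
  replace c with (a - (b + b)) by (unfold b; field; apply RtoC_neq; lra).
  unfold gauss, raise. push_euler.
  rewrite !cst_sub, !cst_add, ?cst_2, !cst_sub, !cst_add.
  pose proof (geom_X 1) as HX.
  assert (HX' : (X * geom 1)%fps = (geom 1 - cst 1)%fps) by (rewrite <- HX; ring).
  clear HX.
  generalize dependent (geom 1). intros j HX.
  ring [HX].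
Qed.

(** * Pulling the second-order operator back along the quadratic substitutions *)

(** The substitutions [4 x / (1 + x)^2], [4 x (1 - x)] and
    [4 x (x - 1) / (1 - 2 x)^2]; the first is [- 4 K(- x)] for the Koebe
    function [K], the second is the logistic map, and the third is obtained
    from the second by Pfaff's substitution [w / (w - 1)]. *)
Definition koebe_series : fps := (cst 4 * (X * (geom (-1) * geom (-1))))%fps.
Definition logistic_series : fps := (cst 4 * (X * one_sub 1))%fps.
Definition pfaff_series : fps := (- (cst 4 * (X * (one_sub 1 * (geom 2 * geom 2)))))%fps.

Lemma koebe_series_euler : euler koebe_series = ((cst 2 * geom (-1) - cst 1) * koebe_series)%fps.
Proof. unfold koebe_series. push_euler. rewrite cst_2. ring. Qed.

Lemma geom_X_1 : (X * geom 1)%fps = (geom 1 - cst 1)%fps.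
Proof. rewrite <- (geom_X 1). ring. Qed.
Lemma geom_X_m1 : (X * geom (-1))%fps = (cst 1 - geom (-1))%fps.
Proof.
  pose proof (geom_X (-1)) as H.
  replace (cst (-1)) with (- cst 1)%fps in H by (rewrite <- cst_opp; f_equal; ring).
  replace (X * geom (-1))%fps with (- (- cst 1 * X * geom (-1)))%fps by ring.
  rewrite H. ring.
Qed.
Lemma geom_X_2 : (cst 2 * X * geom 2)%fps = (geom 2 - cst 1)%fps.
Proof. apply geom_X. Qed.

Lemma logistic_series_euler : euler logistic_series = ((cst 2 - geom 1) * logistic_series)%fps.
Proof.
  unfold logistic_series, one_sub. push_euler. rewrite cst_2.
  pose proof geom_X_1 as HX. generalize dependent (geom 1). intros j HX. ring [HX].
Qed.

Lemma pfaff_series_euler : euler pfaff_series = ((cst 2 * geom 2 - geom 1) * pfaff_series)%fps.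
Proof.
  unfold pfaff_series, one_sub. push_euler. rewrite cst_2.
  pose proof geom_X_1 as HX. generalize dependent (geom 1). intros j HX. ring [HX].
Qed.

Ltac push_comp Hy :=
  repeat (progress rewrite ?comp_add, ?comp_sub, ?comp_cst_mul, ?(comp_X_mul _ _ Hy)).

Lemma koebe_series_0 : koebe_series O = 0.
Proof. unfold koebe_series. rewrite fmul_cst, fmul_X_0. ring. Qed.
Lemma logistic_series_0 : logistic_series O = 0.
Proof. unfold logistic_series. rewrite fmul_cst, fmul_X_0. ring. Qed.
Lemma pfaff_series_0 : pfaff_series O = 0.
Proof. unfold pfaff_series, fopp. rewrite fmul_cst, fmul_X_0. ring. Qed.

(** After expanding theta through products and substitutions both sides are linear
    in the three series [comp y (theta^i g)], with coefficients polynomial in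
    [j = 1 / (1 + x)]; they agree modulo the relation [X j = 1 - j]. *)
Lemma koebe_intertwines beta g :
  let P := pw (-1) (- (2 * beta)) in
  let D := fun u => (cst 2 * euler (euler u + cst (2 * beta) * u))%fps in
  D (P * comp koebe_series g)%fps = (P * comp koebe_series (gauss (2 * beta + 1) beta g))%fps.
Proof.
  cbv zeta beta. unfold gauss, raise.
  replace (2 * beta + 1 - 1) with (2 * beta) by ring.
  push_euler. push_comp koebe_series_0.
  rewrite ?(euler_comp _ _ koebe_series_0 koebe_series_euler). push_euler.
  rewrite ?(euler_comp _ _ koebe_series_0 koebe_series_euler).
  generalize (comp koebe_series g) (comp koebe_series (euler g)) (comp koebe_series (euler (euler g))).
  intros G0 G1 G2. unfold koebe_series.
  (* Write every numeral as a sum of units, the only constants that [ring] recognizes. *)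
  replace (cst 4) with (cst 2 + cst 2)%fps by (rewrite <- cst_add; f_equal; ring).
  rewrite !cst_add, !cst_opp, !cst_mul, cst_2.
  pose proof geom_X_m1 as HX. generalize dependent (geom (-1)). intros j HX.
  generalize (pw (-1) (- (2 * beta))). intros P.
  ring [HX].
Qed.

(** Here the coefficients are polynomials in [X] and [j = 1 / (1 - x)]. *)
Lemma logistic_intertwines a c beta g : 2 * beta = a + c - 1 ->
  quad (a + c) c (pw 1 (a - 1) * comp logistic_series g)%fps
  = (pw 1 (a - 1) * comp logistic_series (gauss (a + c) beta g))%fps.
Proof.
  intros Hb. replace c with (2 * beta + 1 - a) by (rewrite Hb; ring).
  unfold gauss, quad, raise.
  push_euler. push_comp logistic_series_0.
  rewrite ?(euler_comp _ _ logistic_series_0 logistic_series_euler). push_euler.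
  rewrite ?(euler_comp _ _ logistic_series_0 logistic_series_euler). push_euler.
  generalize (comp logistic_series g) (comp logistic_series (euler g)) (comp logistic_series (euler (euler g))).
  intros G0 G1 G2. unfold logistic_series, one_sub.
  replace (cst 4) with (cst 2 + cst 2)%fps by (rewrite <- cst_add; f_equal; ring).
  rewrite !cst_sub, !cst_add, !cst_sub, !cst_add, !cst_mul, cst_2.
  pose proof geom_X_1 as HX.  generalize dependent (geom 1). intros j HX.
  generalize (pw 1 (a - 1)). intros P.
  ring [HX].
Qed.

(** A partial fraction decomposition. *)
Lemma geom_1_2 : (geom 1 * geom 2)%fps = (cst 2 * geom 2 - geom 1)%fps.
Proof.
  transitivity (cst 2 * geom 2 * (one_sub 1 * geom 1) - geom 1 * (one_sub 2 * geom 2))%fps.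
  - unfold one_sub. rewrite cst_2. ring.
  - rewrite !one_sub_geom. ring.
Qed.

(** The expansion of [(1 - y)^beta] in [x], for the third substitution. *)
Definition pfaff_factor (beta : C) : fps := comp pfaff_series (pw 1 beta).
Lemma one_sub_pfaff_series : (cst 1 - pfaff_series)%fps = (geom 2 * geom 2)%fps.
Proof. 
  unfold pfaff_series, one_sub. pose proof geom_X_2 as HX. 
  replace (cst 4) with (cst 2 * cst 2)%fps by (rewrite <- cst_mul; f_equal; ring).
  transitivity (cst 1 + (cst 2 * X * geom 2) * (cst 2 * geom 2 - cst 2 * X * geom 2))%fps; [ring|].
  rewrite HX, cst_2. ring.
Qed.

Lemma pfaff_factor_0 beta : pfaff_factor beta O = 1.
Proof. unfold pfaff_factor, comp. rewrite sum_n_C_0. simpl. ring. Qed.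

(** Since [1 - y = (1 - 2 x)^(-2)], the factor is [(1 - 2 x)^(-2 beta)]. *)
Lemma pfaff_factor_euler beta : euler (pfaff_factor beta) = (cst (2 * beta) * ((geom 2 - cst 1) * pfaff_factor beta))%fps.
Proof.
  pose proof (f_equal (comp pfaff_series) (pw_euler 1 beta)) as E.
  unfold one_sub in E.
  replace ((cst 1 - cst 1 * X) * euler (pw 1 beta))%fps with (euler (pw 1 beta) - X * euler (pw 1 beta))%fps in E by ring.
  replace (- (cst (beta * 1) * (X * pw 1 beta)))%fps with (cst (- (1)) * (cst (beta * 1) * (X * pw 1 beta)))%fps in E
    by (rewrite cst_opp; ring).
  rewrite comp_sub, !comp_cst_mul, !(comp_X_mul _ _ pfaff_series_0) in E. fold (pfaff_factor beta) in E.
  assert (E1 : euler (pfaff_factor beta) = ((cst 2 * geom 2 - geom 1) * comp pfaff_series (euler (pw 1 beta)))%fps)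
    by exact (euler_comp _ _ pfaff_series_0 pfaff_series_euler (pw 1 beta)).
  rewrite E1. generalize dependent (comp pfaff_series (euler (pw 1 beta))). intros Q E _.
  assert (E2 : (geom 2 * geom 2 * Q)%fps = (cst (- (1)) * (cst (beta * 1) * (pfaff_series * pfaff_factor beta)))%fps).
  { rewrite <- E, <- one_sub_pfaff_series. ring. }
  generalize dependent (pfaff_factor beta). intros P _ E2.
  apply (f_equal (fun w => one_sub 2 * (one_sub 2 * w))%fps) in E2.
  replace (one_sub 2 * (one_sub 2 * (geom 2 * geom 2 * Q)))%fps
    with ((one_sub 2 * geom 2) * (one_sub 2 * geom 2) * Q)%fps in E2 by ring.
  rewrite one_sub_geom in E2. rewrite <- geom_1_2.
  replace Q with (cst 1 * cst 1 * Q)%fps by ring. rewrite E2.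
  unfold pfaff_series.
  rewrite cst_opp, !cst_mul. rewrite <- geom_X_2.
  replace (cst 4) with (cst 2 * cst 2)%fps by (rewrite <- cst_mul; f_equal; ring).
  transitivity (cst beta * (cst 2 * cst 2 * X * geom 2 * P) * (one_sub 1 * geom 1) * (one_sub 2 * geom 2) * (one_sub 2 * geom 2))%fps; [ring|].
  rewrite !one_sub_geom. ring.
Qed.

(** Now [j = 1 / (1 - x)] and [k = 1 / (1 - 2 x)] both occur; the product [j k] is
    removed by partial fractions. *)
Lemma pfaff_intertwines a c beta g : 2 * beta = a + c - 1 ->
  quad (a + c) c (pw 1 (a - 1) * (pfaff_factor beta * comp pfaff_series g))%fps
  = (pw 1 (a - 1) * (pfaff_factor beta * comp pfaff_series (gauss (a + c) beta g)))%fps.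
Proof.
  intros Hb. replace c with (2 * beta + 1 - a) by (rewrite Hb; ring).
  unfold gauss, quad, raise.
  push_euler. rewrite !pfaff_factor_euler. push_comp pfaff_series_0.
  rewrite ?(euler_comp _ _ pfaff_series_0 pfaff_series_euler). push_euler. rewrite !pfaff_factor_euler.
  rewrite ?(euler_comp _ _ pfaff_series_0 pfaff_series_euler). push_euler.
  generalize (comp pfaff_series g) (comp pfaff_series (euler g)) (comp pfaff_series (euler (euler g))).
  intros G0 G1 G2. unfold pfaff_series, one_sub.
  replace (cst 4) with (cst 2 + cst 2)%fps by (rewrite <- cst_add; f_equal; ring).
  rewrite !cst_sub, !cst_add, !cst_sub, !cst_add, !cst_mul, cst_2.
  pose proof geom_X_1 as HX. pose proof geom_1_2 as H12. pose proof geom_X_2 as H2.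
  rewrite cst_2 in *.
  generalize dependent (geom 1). generalize dependent (geom 2). intros k Hk j Hj Hjk.
  generalize (pw 1 (a - 1)) (pfaff_factor beta). intros P P'.
  assert (HH : (X * k * (cst 1 + cst 1))%fps = (k - cst 1)%fps) by (rewrite <- Hk; ring).
  ring [Hj Hjk HH].
Qed.

(** * Uniqueness of triangular intertwiners *)

(** [T] respects the filtration by order of vanishing and acts on its [n]-th graded
    piece as [lam n]. *)
Definition triangular (T : fps -> fps) (lam : nat -> C) : Prop :=
  forall n u, below n u -> below n (T u) /\ T u n = lam n * u n.

Lemma triangular_euler : triangular euler (fun n => RtoC (INR n)).
Proof. intros n u Hu; split; [|reflexivity]. intros k Hk. unfold euler. rewrite Hu by lia. ring. Qed.

Lemma triangular_cst k : triangular (fun u => cst k * u)%fps (fun _ => k).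
Proof. intros n u Hu; split; [|apply fmul_cst]. intros j Hj. rewrite fmul_cst, Hu by lia. ring. Qed.

Lemma triangular_add S T l m : triangular S l -> triangular T m ->
  triangular (fun u => S u + T u)%fps (fun n => l n + m n).
Proof.
  intros HS HT n u Hu. destruct (HS n u Hu) as [H1 H2], (HT n u Hu) as [H3 H4].
  unfold fadd; split; [|rewrite H2, H4; ring].
  intros k Hk. rewrite H1, H3 by lia. ring.
Qed.

Lemma triangular_sub S T l m : triangular S l -> triangular T m ->
  triangular (fun u => S u - T u)%fps (fun n => l n - m n).
Proof.
  intros HS HT n u Hu. destruct (HS n u Hu) as [H1 H2], (HT n u Hu) as [H3 H4].
  unfold fsub; split; [|rewrite H2, H4; ring].
  intros k Hk. rewrite H1, H3 by lia. ring.
Qed.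

Lemma triangular_comp S T l m : triangular S l -> triangular T m ->
  triangular (fun u => S (T u)) (fun n => l n * m n).
Proof.
  intros HS HT n u Hu. destruct (HT n u Hu) as [H1 H2], (HS n _ H1) as [H3 H4].
  split; [exact H3|]. rewrite H4, H2. ring.
Qed.

Lemma triangular_X : triangular (fun u => X * u)%fps (fun _ => 0).
Proof.
  intros n u Hu; split.
  - intros [|k] Hk; [apply fmul_X_0|]. rewrite fmul_X_S. apply Hu; lia.
  - destruct n as [|n]; [rewrite fmul_X_0; ring|]. rewrite fmul_X_S, Hu by lia. ring.
Qed.

Lemma triangular_ext T l m : (forall n, l n = m n) -> triangular T l -> triangular T m.
Proof. intros E H n u Hu. rewrite <- E. now apply H. Qed.

Lemma triangular_raise p : triangular (raise p) (fun _ => 0).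
Proof.
  apply (triangular_ext _ (fun n => 0 * (RtoC (INR n) + p))); [intros; ring|].
  apply (triangular_comp (fun u => X * u)%fps); [apply triangular_X|].
  apply triangular_add; [apply triangular_euler|apply triangular_cst].
Qed.

(** The indicial polynomial of [gauss e p] and of [quad e p]; with
    [e - 1 = 2 beta] it is [2 n (n + 2 beta)]. *)
Definition exponent (e : C) (n : nat) : C := 2 * (RtoC (INR n) * (RtoC (INR n) + (e - 1))).

Lemma triangular_principal e :
  triangular (fun u => cst 2 * euler (euler u + cst (e - 1) * u))%fps (exponent e).
Proof.
  apply (triangular_comp (fun u => cst 2 * u)%fps); [apply triangular_cst|].
  apply (triangular_comp euler); [apply triangular_euler|].
  apply triangular_add; [apply triangular_euler|apply triangular_cst].
Qed.

Lemma triangular_first_order e :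
  triangular (fun u => cst 2 * euler u + cst e * u)%fps (fun n => 2 * RtoC (INR n) + e).
Proof.
  apply triangular_add; [|apply triangular_cst].
  apply (triangular_comp (fun u => cst 2 * u)%fps); [apply triangular_cst|apply triangular_euler].
Qed.

Lemma triangular_gauss e p : triangular (gauss e p) (exponent e).
Proof.
  apply (triangular_ext _ (fun n => exponent e n - 0 * (2 * RtoC (INR n) + e))); [intros; ring|].
  apply triangular_sub; [apply triangular_principal|].
  apply (triangular_comp (raise p)); [apply triangular_raise|apply triangular_first_order].
Qed.

Lemma triangular_quad e p : triangular (quad e p) (exponent e).
Proof.
  apply (triangular_ext _ (fun n => exponent e n - 2 * (0 * (2 * RtoC (INR n) + e)) + 2 * (0 * 0)));
    [intros; ring|].
  apply triangular_add; [apply triangular_sub; [apply triangular_principal|]|];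
    apply (triangular_comp (fun u => cst 2 * u)%fps); try apply triangular_cst.
  - apply (triangular_comp (raise p)); [apply triangular_raise|apply triangular_first_order].
  - apply (triangular_comp (raise p)); apply triangular_raise.
Qed.

(** The difference of two values is [2 (n - m) (n + m + e - 1)]. *)
Lemma exponent_inj e : (forall k, (1 <= k)%nat -> e - 1 + INR k <> 0) ->
  forall m n, (m < n)%nat -> exponent e m <> exponent e n.
Proof.
  intros He m n Hmn E. unfold exponent in E.
  assert (H : (RtoC (INR n) - INR m) * (e - 1 + INR (n + m)) = 0).
  { rewrite plus_INR, RtoC_plus.
    transitivity ((2 * (INR n * (INR n + (e - 1))) - 2 * (INR m * (INR m + (e - 1)))) / 2).
    - field.
    - rewrite E. field. }
  revert H. apply Cmult_neq_0; [|apply He; lia].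
  rewrite <- RtoC_minus. apply RtoC_neq. apply lt_INR in Hmn. lra.
Qed.

(** If [D] raises the order of vanishing by [k], the induced map from the [n]-th to
    the [(n + k)]-th graded piece intertwines the scalars [lam n] and
    [lam (n + k)], hence vanishes, and [D] raises the order by [k + 1]. *)
Lemma commuting_zero (D S T : fps -> fps) (lam : nat -> C) :
  (forall u v k, D (u - cst k * v)%fps = (D u - cst k * D v)%fps) ->
  (forall n u, below n u -> below (1 + n) (D u)) ->
  triangular S lam -> triangular T lam ->
  (forall m n, (m < n)%nat -> lam m <> lam n) ->
  (forall u, D (T u) = S (D u)) ->
  forall u, D u = cst 0.
Proof.
  intros Dlin Dlow HS HT Hlam HD.
  assert (H : forall k n u, below n u -> below (1 + k + n) (D u)).
  { induction k as [|k IH]; intros n u Hu; [now apply Dlow|].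
    assert (Hm : D u (1 + k + n)%nat = 0).
    { destruct (HT n u Hu) as [H1 H2].
      (* Removing the leading term of [T u] makes the induction hypothesis gain one order. *)
      assert (H3 : below (1 + n) (T u - cst (lam n) * u)%fps).
      { intros j Hj. unfold fsub. rewrite fmul_cst.
        destruct (Nat.eq_dec j n) as [->|Hj']; [rewrite H2; ring|].
        rewrite H1, Hu by lia. ring. }
      pose proof (IH _ _ H3 (1 + k + n)%nat ltac:(lia)) as E.
      rewrite Dlin, HD in E. unfold fsub in E. rewrite fmul_cst in E.
      rewrite (proj2 (HS _ _ (IH n u Hu))) in E.
      destruct (Ceq_dec (D u (1 + k + n)%nat) 0) as [H0|H0]; [exact H0|exfalso].
      assert (E' : (lam (1 + k + n)%nat - lam n) * D u (1 + k + n)%nat = 0) by (rewrite <- E; ring).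
      revert E'. apply Cmult_neq_0; [|exact H0].
      intros E'. apply (Hlam n (1 + k + n)%nat); [lia|].
      transitivity (lam (1 + k + n)%nat - (lam (1 + k + n)%nat - lam n)); [ring|]. rewrite E'. ring. }
    intros j Hj. destruct (Nat.eq_dec j (1 + k + n)) as [->|Hj']; [exact Hm|].
    apply (IH n u Hu). lia. }
  intros u. apply fps_ext; intros n.
  transitivity (RtoC 0); [|now destruct n].
  apply (H n O u); [intros k Hk; lia|lia].
Qed.

(** The right-hand side of the identities, in the coordinate [y]. *)
Definition bridge (a c beta : C) (u : fps) : fps :=
  hyp beta c (pw 1 ((a - c) / 2) * hyp a beta u)%fps.

Lemma bridge_gauss a c beta u : ~ nonpos_int c -> ~ nonpos_int beta ->
  bridge a c beta (gauss (a + c) beta u) = gauss (a + c) beta (bridge a c beta u).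
Proof.
  intros Hc Hb. unfold bridge.
  rewrite hyp_gauss, <- gauss_mul_pw, hyp_gauss by assumption. reflexivity.
Qed.

Lemma hyp_lin a c u v k : hyp a c (u - cst k * v)%fps = (hyp a c u - cst k * hyp a c v)%fps.
Proof. now rewrite hyp_sub, hyp_cst_mul. Qed.

Lemma comp_lin y u v k : comp y (u - cst k * v)%fps = (comp y u - cst k * comp y v)%fps.
Proof. now rewrite comp_sub, comp_cst_mul. Qed.

Lemma bridge_lin a c beta u v k :
  bridge a c beta (u - cst k * v)%fps = (bridge a c beta u - cst k * bridge a c beta v)%fps.
Proof.
  unfold bridge. rewrite (hyp_lin a beta). generalize (hyp a beta u) (hyp a beta v).
  intros u' v'. rewrite <- hyp_lin. f_equal. ring.
Qed.

Lemma triangular_hyp a c : triangular (hyp a c) (fun n => poch a n / poch c n).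
Proof.
  intros n u Hu; split; [|unfold hyp; ring].
  intros k Hk. unfold hyp. rewrite Hu by lia. ring.
Qed.

Lemma triangular_mul P : triangular (fun u => P * u)%fps (fun _ => P O).
Proof.
  intros n u Hu. apply (fmul_below 0 n P u); [intros k Hk; lia|exact Hu].
Qed.

Lemma triangular_comp_with y : y O = 0 -> triangular (comp y) (fun n => Cpow (y 1%nat) n).
Proof. intros Hy n u Hu. destruct (comp_below y n u Hy Hu) as [H1 H2]. split; [exact H1|rewrite H2; ring]. Qed.

Lemma triangular_bridge a c beta : ~ nonpos_int c -> ~ nonpos_int beta ->
  triangular (bridge a c beta) (fun n => poch a n / poch c n).
Proof.
  intros Hc Hb.
  apply (triangular_ext _ (fun n => (poch beta n / poch c n) * (1 * (poch a n / poch beta n)))).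
  - intros n. field. split; apply poch_neq_0; assumption.
  - apply (triangular_comp (hyp beta c)); [apply triangular_hyp|].
    apply (triangular_comp (fun u => pw 1 ((a - c) / 2) * u)%fps); [apply triangular_mul|apply triangular_hyp].
Qed.

(** The argument common to the three substitutions, away from resonances.  [P] and
    [Q] are the powers to the right and to the left of the hypergeometrization (the
    latter moved to the other side), [S] and [T] the operators into which
    [gauss (a + c) beta] is carried by them. *)
Lemma intertwining_generic a c beta (y P Q : fps) (S T : fps -> fps) :
  ~ nonpos_int c -> ~ nonpos_int beta ->
  (forall k, (1 <= k)%nat -> a + c - 1 + INR k <> 0) ->
  y O = 0 -> P O = 1 -> Q O = 1 ->
  (forall g, S (P * comp y g)%fps = (P * comp y (gauss (a + c) beta g))%fps) ->
  (forall g, T (Q * comp y g)%fps = (Q * comp y (gauss (a + c) beta g))%fps) ->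
  (forall u, hyp a c (S u) = T (hyp a c u)) ->
  (forall u v, T (u - v)%fps = (T u - T v)%fps) ->
  triangular T (exponent (a + c)) ->
  forall v, hyp a c (P * comp y v)%fps = (Q * comp y (bridge a c beta v))%fps.
Proof.
  intros Hc Hb Hres Hy HP HQ HS HT HST Tsub Ttri v.
  pose (D := fun v => (hyp a c (P * comp y v) - Q * comp y (bridge a c beta v))%fps).
  assert (H : D v = cst 0).
  { apply (commuting_zero D T (gauss (a + c) beta) (exponent (a + c))).
    - intros u w k. unfold D. rewrite bridge_lin, !comp_lin.
      replace (P * (comp y u - cst k * comp y w))%fps
        with (P * comp y u - cst k * (P * comp y w))%fps by ring.
      rewrite hyp_lin. ring.
    - intros n u Hu.
      assert (H1 : triangular D (fun _ => 0)).
      { unfold D. apply (triangular_ext _ (fun n =>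
          (poch a n / poch c n) * (P O * Cpow (y 1%nat) n)
          - Q O * (Cpow (y 1%nat) n * (poch a n / poch c n)))); [intros; rewrite HP, HQ; ring|].
        apply triangular_sub.
        - apply (triangular_comp (hyp a c)); [apply triangular_hyp|].
          apply (triangular_comp (fun u => P * u)%fps); [apply triangular_mul|now apply triangular_comp_with].
        - apply (triangular_comp (fun u => Q * u)%fps); [apply triangular_mul|].
          apply (triangular_comp (comp y)); [now apply triangular_comp_with|now apply triangular_bridge]. }
      destruct (H1 n u Hu) as [H2 H3].
      intros k Hk. destruct (Nat.eq_dec k n) as [->|Hk']; [rewrite H3; ring|apply H2; lia].
    - exact Ttri.
    - apply triangular_gauss.
    - now apply exponent_inj.
    - intros u. unfold D. rewrite Tsub, bridge_gauss by assumption.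
      now rewrite HT, <- HST, HS. }
  unfold D in H. rewrite <- (fps_ring_theory.(Radd_0_l) (Q * _)%fps), <- H. ring.
Qed.

(** * Removing the resonances by continuity in the parameter *)

Open Scope R_scope.

(** Lipschitz continuity at 0.  It is stable under sums, products and inverses with
    shorter estimates than mere continuity, and rational functions of the parameter
    have it. *)
Definition lip (f : C -> C) : Prop :=
  exists K r : R, 0 < r /\ 0 <= K /\
    forall e, Cmod e < r -> Cmod (f e - f (RtoC 0))%C <= K * Cmod e.

Lemma lip_const k : lip (fun _ => k).
Proof.
  exists 0, 1. repeat split; try lra. intros e _.
  replace (k - k)%C with (RtoC 0) by ring. rewrite Cmod_0. lra.
Qed.

Lemma lip_id : lip (fun e => e).
Proof.
  exists 1, 1. repeat split; try lra. intros e _.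
  replace (e - 0)%C with e by ring. lra.
Qed.

Lemma lip_plus f g : lip f -> lip g -> lip (fun e => (f e + g e)%C).
Proof.
  intros (K & r & Hr & HK & Hf) (L & s & Hs & HL & Hg).
  exists (K + L), (Rmin r s). repeat split; [now apply Rmin_pos|lra|].
  intros e He. pose proof (Rmin_l r s). pose proof (Rmin_r r s).
  replace (f e + g e - (f 0 + g 0))%C with ((f e - f 0) + (g e - g 0))%C by ring.
  eapply Rle_trans; [apply Cmod_triangle|].
  specialize (Hf e ltac:(lra)). specialize (Hg e ltac:(lra)). lra.
Qed.

Lemma lip_bound f : lip f -> exists B r, 0 < r /\ 0 <= B /\ forall e, Cmod e < r -> Cmod (f e) <= B.
Proof.
  intros (K & r & Hr & HK & Hf). exists (K * r + Cmod (f (RtoC 0))), r.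
  pose proof (Cmod_ge_0 (f (RtoC 0))).
  repeat split; [lra| |].
  - apply Rplus_le_le_0_compat; [|lra]. apply Rmult_le_pos; lra.
  - intros e He. replace (f e) with ((f e - f 0) + f 0)%C by ring.
    eapply Rle_trans; [apply Cmod_triangle|].
    apply Rplus_le_compat_r. eapply Rle_trans; [now apply Hf|]. apply Rmult_le_compat_l; lra.
Qed.

Lemma lip_mult f g : lip f -> lip g -> lip (fun e => (f e * g e)%C).
Proof.
  intros Hf Hg. destruct (lip_bound g Hg) as (B & t & Ht & HB & Hgb).
  destruct Hf as (K & r & Hr & HK & Hf), Hg as (L & s & Hs & HL & Hg).
  set (F := Cmod (f (RtoC 0))). assert (HF : 0 <= F) by apply Cmod_ge_0.
  exists (K * B + F * L), (Rmin r (Rmin s t)).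
  repeat split; [repeat apply Rmin_pos; assumption| |].
  { apply Rplus_le_le_0_compat; now apply Rmult_le_pos. }
  intros e He. pose proof (Rmin_l r (Rmin s t)). pose proof (Rmin_r r (Rmin s t)).
  pose proof (Rmin_l s t). pose proof (Rmin_r s t).
  replace (f e * g e - f 0 * g 0)%C with ((f e - f 0) * g e + f 0 * (g e - g 0))%C by ring.
  eapply Rle_trans; [apply Cmod_triangle|]. rewrite !Cmod_mult. fold F.
  specialize (Hf e ltac:(lra)). specialize (Hg e ltac:(lra)). specialize (Hgb e ltac:(lra)).
  pose proof (Cmod_ge_0 (f e - f 0)%C). pose proof (Cmod_ge_0 (g e)). pose proof (Cmod_ge_0 e).
  assert (Cmod (f e - f 0)%C * Cmod (g e) <= K * Cmod e * B) by (apply Rmult_le_compat; lra).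
  assert (F * Cmod (g e - g 0)%C <= F * (L * Cmod e)) by (apply Rmult_le_compat_l; lra).
  lra.
Qed.

Lemma lip_inv f : f (RtoC 0) <> RtoC 0 -> lip f -> lip (fun e => (/ f e)%C).
Proof.
  intros H0 (K & r & Hr & HK & Hf).
  set (m := Cmod (f (RtoC 0))). assert (Hm : 0 < m) by now apply Cmod_gt_0.
  exists (K * (2 / (m * m))), (Rmin r (m / (2 * (K + 1)))).
  assert (Hq : 0 < m / (2 * (K + 1))) by (apply Rdiv_lt_0_compat; lra).
  assert (Hmm : 0 < 2 / (m * m)) by (apply Rdiv_lt_0_compat; [lra|now apply Rmult_lt_0_compat]).
  repeat split; [now apply Rmin_pos|apply Rmult_le_pos; lra|].
  intros e He. pose proof (Rmin_l r (m / (2 * (K + 1)))). pose proof (Rmin_r r (m / (2 * (K + 1)))).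
  specialize (Hf e ltac:(lra)). pose proof (Cmod_ge_0 e).
  assert (HKe : K * Cmod e <= m / 2).
  { apply Rle_trans with (K * (m / (2 * (K + 1)))); [apply Rmult_le_compat_l; lra|].
    apply Rmult_le_reg_r with (2 * (K + 1)); [lra|].
    replace (K * (m / (2 * (K + 1))) * (2 * (K + 1))) with (K * m) by (field; lra).
    replace (m / 2 * (2 * (K + 1))) with (K * m + m) by field. lra. }
  assert (Hlow : m / 2 <= Cmod (f e)).
  { assert (Htri : m <= Cmod (f e) + Cmod (f e - f 0)%C).
    { unfold m. replace (f (RtoC 0)) with (f e + - (f e - f 0))%C at 1 by ring.
      eapply Rle_trans; [apply Cmod_triangle|]. rewrite Cmod_opp. lra. }
    lra. }
  assert (Hfe : f e <> RtoC 0) by (apply Cmod_gt_0; lra).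
  replace (/ f e - / f 0)%C with (- (f e - f 0) * / (f e * f 0))%C by (field; now split).
  rewrite Cmod_mult, Cmod_opp, Cmod_inv, Cmod_mult by (now apply Cmult_neq_0). fold m.
  replace (K * (2 / (m * m)) * Cmod e) with (K * Cmod e * (2 / (m * m))) by ring.
  apply Rmult_le_compat; [apply Cmod_ge_0| |exact Hf|].
  - left. apply Rinv_0_lt_compat, Rmult_lt_0_compat; lra.
  - replace (2 / (m * m)) with (/ (m / 2 * m)) by (field; lra).
    apply Rinv_le_contravar; [apply Rmult_lt_0_compat; lra|]. apply Rmult_le_compat_r; lra.
Qed.

(** Identities extend from a punctured neighbourhood to its centre. *)
Lemma lip_limit f r : lip f -> 0 < r ->
  (forall e, 0 < Cmod e < r -> f e = RtoC 0) -> f (RtoC 0) = RtoC 0.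
Proof.
  intros (K & s & Hs & HK & Hf) Hr H.
  destruct (Ceq_dec (f (RtoC 0)) 0) as [H0|H0]; [exact H0|exfalso].
  set (m := Cmod (f (RtoC 0))). assert (Hm : 0 < m) by now apply Cmod_gt_0.
  set (t := Rmin (Rmin r s / 2) (m / (2 * (K + 1)))).
  assert (Hq : 0 < m / (2 * (K + 1))) by (apply Rdiv_lt_0_compat; lra).
  assert (Hrs : 0 < Rmin r s) by now apply Rmin_pos.
  pose proof (Rmin_l r s). pose proof (Rmin_r r s).
  assert (Ht : 0 < t) by (apply Rmin_pos; lra).
  pose proof (Ha := Rmin_l (Rmin r s / 2) (m / (2 * (K + 1)))). 
  pose proof (Hb := Rmin_r (Rmin r s / 2) (m / (2 * (K + 1)))). fold t in Ha, Hb.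
  assert (Et : Cmod t = t) by (rewrite Cmod_R, Rabs_right; lra).
  specialize (Hf t ltac:(lra)). rewrite H, Et in Hf by lra.
  replace (0 - f 0)%C with (- f 0)%C in Hf by ring. rewrite Cmod_opp in Hf. fold m in Hf.
  assert (K * t <= K * (m / (2 * (K + 1)))) by (apply Rmult_le_compat_l; lra).
  assert (K * (m / (2 * (K + 1))) < m).
  { apply Rmult_lt_reg_r with (2 * (K + 1)); [lra|].
    replace (K * (m / (2 * (K + 1))) * (2 * (K + 1))) with (K * m) by (field; lra).
    assert (0 <= K * m) by (apply Rmult_le_pos; lra). lra. }
  lra.
Qed.

Lemma lip_opp f : lip f -> lip (fun e => (- f e)%C).
Proof.
  intros H. replace (fun e => (- f e)%C) with (fun e => (- RtoC 1 * f e)%C).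
  - apply lip_mult; [apply lip_const|exact H].
  - apply functional_extensionality; intros e. ring.
Qed.

Lemma lip_minus f g : lip f -> lip g -> lip (fun e => (f e - g e)%C).
Proof. intros Hf Hg. apply lip_plus; [exact Hf|now apply lip_opp]. Qed.

Definition lips (U : C -> fps) : Prop := forall n, lip (fun e => U e n).

Lemma lips_mul U V : lips U -> lips V -> lips (fun e => (U e * V e)%fps).
Proof.
  intros HU HV n; revert U HU; induction n as [|n IH]; intros U HU.
  - apply lip_mult; [apply HU|apply HV].
  - apply (lip_plus (fun e => U e O * V e (S n))%C (fun e => fmul (tl (U e)) (V e) n)).
    + apply lip_mult; [apply HU|apply HV].
    + apply (IH (fun e => tl (U e))). intros k. apply HU.
Qed.

Lemma lips_const u : lips (fun _ => u).
Proof. intros n. apply lip_const. Qed.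

Lemma lip_sum (f : C -> nat -> C) n : (forall k, lip (fun e => f e k)) ->
  lip (fun e => sum_n (f e) n).
Proof.
  intros H; induction n as [|n IH].
  - replace (fun e => sum_n (f e) 0) with (fun e => f e O); [apply H|].
    apply functional_extensionality; intros e. now rewrite sum_n_C_0.
  - replace (fun e => sum_n (f e) (S n)) with (fun e => (sum_n (f e) n + f e (S n))%C).
    + now apply (lip_plus (fun e => sum_n (f e) n) (fun e => f e (S n))).
    + apply functional_extensionality; intros e. now rewrite sum_n_C_S.
Qed.

Lemma lips_comp y U : lips U -> lips (fun e => comp y (U e)).
Proof.
  intros HU n. apply (lip_sum (fun e k => (U e k * fpow y k n)%C)). intros k.
  apply lip_mult; [apply HU|apply lip_const].
Qed.

Lemma lips_pw k (s : C -> C) : lip s -> lips (fun e => pw k (s e)).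
Proof.
  intros Hs n; induction n as [|n IH]; [apply (lip_const (RtoC 1))|].
  apply (lip_mult (fun e => pw k (s e) n) (fun e => k * (INR n - s e) / INR (S n))%C); [exact IH|].
  apply (lip_mult (fun e => k * (INR n - s e))%C (fun _ => / INR (S n))%C); [|apply lip_const].
  apply (lip_mult (fun _ => k) (fun e => INR n - s e)%C); [apply lip_const|].
  apply lip_minus; [apply lip_const|exact Hs].
Qed.

Lemma lip_poch (q : C -> C) n : lip q -> lip (fun e => poch (q e) n).
Proof.
  intros Hq; induction n as [|n IH]; [apply (lip_const (RtoC 1))|].
  apply (lip_mult (fun e => poch (q e) n) (fun e => (q e + INR n)%C)); [exact IH|].
  apply lip_plus; [exact Hq|apply lip_const].
Qed.

Lemma lips_hyp (a c : C -> C) U : ~ nonpos_int (c (RtoC 0)) -> lip a -> lip c -> lips U ->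
  lips (fun e => hyp (a e) (c e) (U e)).
Proof.
  intros H0 Ha Hc HU n.
  apply lip_mult; [apply HU|]. apply lip_mult; [now apply lip_poch|].
  apply lip_inv; [now apply poch_neq_0|now apply lip_poch].
Qed.

(** Beyond [Cmod z + 1] the integers stay at distance 1 from [- z], and before it
    there are finitely many of them. *)
Lemma nonpos_int_isolated (z : C) :
  exists r, 0 < r /\ forall k, (z + INR k = 0)%C \/ r <= Cmod (z + INR k)%C.
Proof.
  assert (H : forall N, exists r, 0 < r /\
    forall k, (k < N)%nat -> (z + INR k = 0)%C \/ r <= Cmod (z + INR k)%C).
  { induction N as [|N (r & Hr & IH)]; [exists 1; split; [lra|intros; lia]|].
    destruct (Ceq_dec (z + INR N)%C 0) as [E|E].
    - exists r; split; [exact Hr|]. intros k Hk.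
      destruct (Nat.eq_dec k N) as [->|]; [now left|apply IH; lia].
    - assert (Hm : 0 < Cmod (z + INR N)%C) by now apply Cmod_gt_0.
      exists (Rmin r (Cmod (z + INR N)%C)); split; [now apply Rmin_pos|]. intros k Hk.
      destruct (Nat.eq_dec k N) as [->|]; [right; apply Rmin_r|].
      destruct (IH k ltac:(lia)) as [H|H]; [now left|right].
      eapply Rle_trans; [apply Rmin_l|exact H]. }
  destruct (INR_unbounded (Cmod z + 1)) as [N HN].
  destruct (H N) as (r & Hr & HrN).
  exists (Rmin r 1); split; [apply Rmin_pos; lra|]. intros k.
  destruct (Nat.lt_ge_cases k N) as [Hk|Hk].
  - destruct (HrN k Hk) as [E|E]; [now left|right]. eapply Rle_trans; [apply Rmin_l|exact E].
  - right. eapply Rle_trans; [apply Rmin_r|].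
    apply le_INR in Hk.
    assert (Htri : Cmod (INR k) <= Cmod (z + INR k)%C + Cmod z).
    { replace (RtoC (INR k)) with ((z + INR k) + - z)%C at 1 by ring.
      eapply Rle_trans; [apply Cmod_triangle|]. rewrite Cmod_opp. lra. }
    rewrite Cmod_R, Rabs_right in Htri by (apply Rle_ge, pos_INR). lra.
Qed.

(** All the exceptional parameter values, poles and resonances alike, are avoided by
    a small nonzero perturbation. *)
Lemma nonpos_int_punctured (z : C) :
  exists r, 0 < r /\ forall e, 0 < Cmod e < r -> forall k, (z + e + INR k <> 0)%C.
Proof.
  destruct (nonpos_int_isolated z) as (r & Hr & H). exists r; split; [exact Hr|].
  intros e [He1 He2] k E.
  assert (E' : (z + INR k)%C = (- e)%C) by (transitivity (z + e + INR k - e)%C; [ring|rewrite E; ring]).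
  destruct (H k) as [H0|H0]; rewrite E' in H0.
  - apply (f_equal Cmod) in H0. rewrite Cmod_opp, Cmod_0 in H0. lra.
  - rewrite Cmod_opp in H0. lra.
Qed.

Lemma nonpos_int_avoid z : (forall k, (z + INR k <> 0)%C) -> ~ nonpos_int z.
Proof. intros H [k E]. apply (H k). rewrite E. ring. Qed.

(** Replacing [c] by [c + e] and [beta] by [beta + e / 2] keeps
    [2 beta = a + c - 1] and avoids the resonances [2 beta = - k]; both sides depend
    on [e] in a Lipschitz way, so the identity persists at [e = 0]. *)
Lemma intertwining_all_parameters a c beta y (P Q : C -> C -> fps) :
  (2 * beta = a + c - 1)%C -> ~ nonpos_int c -> ~ nonpos_int beta ->
  (forall s t, lip s -> lip t -> lips (fun e => P (s e) (t e))) ->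
  (forall s t, lip s -> lip t -> lips (fun e => Q (s e) (t e))) ->
  (forall c' beta', (2 * beta' = a + c' - 1)%C -> ~ nonpos_int c' -> ~ nonpos_int beta' ->
    (forall k, (1 <= k)%nat -> (a + c' - 1 + INR k <> 0)%C) ->
    forall v, hyp a c' (P c' beta' * comp y v)%fps = (Q c' beta' * comp y (bridge a c' beta' v))%fps) ->
  forall v, hyp a c (P c beta * comp y v)%fps = (Q c beta * comp y (bridge a c beta v))%fps.
Proof.
  intros Hbeta Hc Hb HP HQ H v.
  pose (c' := fun e : C => (c + e)%C). pose (b' := fun e : C => (beta + e / 2)%C).
  assert (Hc' : lip c') by (apply lip_plus; [apply lip_const|apply lip_id]).
  assert (Hb' : lip b').
  { apply lip_plus; [apply lip_const|]. apply lip_mult; [apply lip_id|apply lip_const]. }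
  assert (Ec : c' (RtoC 0) = c) by (unfold c'; ring).
  assert (Eb : b' (RtoC 0) = beta) by (unfold b'; field).
  destruct (nonpos_int_punctured c) as (r1 & Hr1 & H1).
  destruct (nonpos_int_punctured beta) as (r2 & Hr2 & H2).
  destruct (nonpos_int_punctured (a + c - 1)%C) as (r3 & Hr3 & H3).
  apply fps_ext; intros n.
  pose (f := fun e => (hyp a (c' e) (P (c' e) (b' e) * comp y v)%fps n
     - (Q (c' e) (b' e) * comp y (bridge a (c' e) (b' e) v))%fps n)%C).
  assert (Hf : f (RtoC 0) = RtoC 0).
  { apply (lip_limit f (Rmin r1 (Rmin r2 r3))); [| |].
    - apply lip_minus.
      + apply (lips_hyp (fun _ => a) c' (fun e => (P (c' e) (b' e) * comp y v)%fps));
          [now rewrite Ec|apply lip_const|exact Hc'|].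
        apply (lips_mul (fun e => P (c' e) (b' e))); [now apply HP|apply lips_const].
      + apply (lips_mul (fun e => Q (c' e) (b' e))); [now apply HQ|].
        apply (lips_comp y (fun e => bridge a (c' e) (b' e) v)).
        apply (lips_hyp b' c'); [now rewrite Ec|exact Hb'|exact Hc'|].
        apply (lips_mul (fun e => pw 1 ((a - c' e) / 2))).
        * apply lips_pw. apply lip_mult; [|apply lip_const].
          apply lip_minus; [apply lip_const|exact Hc'].
        * apply (lips_hyp (fun _ => a) b' (fun _ => v));
            [now rewrite Eb|apply lip_const|exact Hb'|apply lips_const].
    - repeat apply Rmin_pos; assumption.
    - intros e [He1 He2].
      pose proof (Rmin_l r1 (Rmin r2 r3)). pose proof (Rmin_r r1 (Rmin r2 r3)).
      pose proof (Rmin_l r2 r3). pose proof (Rmin_r r2 r3).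
      unfold f. rewrite H; [ring| | | |].
      + unfold b', c'. replace (2 * (beta + e / 2))%C with (2 * beta + e)%C by field.
        rewrite Hbeta. ring.
      + apply nonpos_int_avoid. apply H1. lra.
      + apply nonpos_int_avoid. apply H2.
        rewrite Cmod_div by (apply RtoC_neq; lra). rewrite Cmod_R, Rabs_right by lra. lra.
      + intros k _. unfold c'. replace (a + (c + e) - 1 + INR k)%C with (a + c - 1 + e + INR k)%C by ring.
        apply H3. lra. }
  unfold f in Hf. rewrite Ec, Eb in Hf.
  match type of Hf with (?l - ?r = _)%C => transitivity (l - r + r)%C; [ring|rewrite Hf; ring] end.
Qed.
Open Scope C_scope.

Lemma quad_sub e p u v : quad e p (u - v)%fps = (quad e p u - quad e p v)%fps.
Proof. unfold quad, raise. push_euler. ring. Qed.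

Lemma formal_koebe_identity a c beta v : 2 * beta = a + c - 1 -> ~ nonpos_int c -> ~ nonpos_int beta ->
  hyp a c (pw (-1) (- (2 * beta)) * comp koebe_series v)%fps
  = (pw (-1) (- (2 * beta)) * comp koebe_series (bridge a c beta v))%fps.
Proof.
  intros Hbeta Hc Hb. revert v.
  apply (intertwining_all_parameters a c beta koebe_series (fun _ b => pw (-1) (- (2 * b))) (fun _ b => pw (-1) (- (2 * b))));
    try assumption.
  1, 2: intros s t Hs Ht; apply lips_pw, lip_opp, lip_mult; [apply lip_const|exact Ht].
  clear c beta Hbeta Hc Hb; intros c beta Hbeta Hc Hb Hres.
  assert (E : a + c = 2 * beta + 1) by (rewrite Hbeta; ring).
  apply (intertwining_generic a c beta koebe_series (pw (-1) (- (2 * beta))) (pw (-1) (- (2 * beta)))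
    (fun u => (cst 2 * euler (euler u + cst (2 * beta) * u))%fps)
    (fun u => (cst 2 * euler (euler u + cst (2 * beta) * u))%fps)); try assumption.
  - exact koebe_series_0.
  - reflexivity.
  - reflexivity.
  - intros g. rewrite E. exact (koebe_intertwines beta g).
  - intros g. rewrite E. exact (koebe_intertwines beta g).
  - intros u. now rewrite hyp_cst_mul, hyp_euler, hyp_add, hyp_cst_mul, hyp_euler.
  - intros u w. push_euler. ring.
  - replace (2 * beta) with (a + c - 1) by (now rewrite Hbeta). apply triangular_principal.
Qed.

Lemma formal_logistic_identity a c beta v : 2 * beta = a + c - 1 -> ~ nonpos_int c -> ~ nonpos_int beta ->
  hyp a c (pw 1 (a - 1) * comp logistic_series v)%fps
  = (pw 1 (c - 1) * comp logistic_series (bridge a c beta v))%fps.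
Proof.
  intros Hbeta Hc Hb. revert v.
  apply (intertwining_all_parameters a c beta logistic_series (fun _ _ => pw 1 (a - 1)) (fun c _ => pw 1 (c - 1)));
    try assumption.
  1: intros; apply lips_const.
  1: intros s t Hs Ht; apply lips_pw, lip_minus; [exact Hs|apply lip_const].
  clear c beta Hbeta Hc Hb; intros c beta Hbeta Hc Hb Hres.
  apply (intertwining_generic a c beta logistic_series (pw 1 (a - 1)) (pw 1 (c - 1)) (quad (a + c) c) (quad (a + c) a)); try assumption.
  - exact logistic_series_0.
  - reflexivity.
  - reflexivity.
  - intros g. now apply logistic_intertwines.
  - intros g. rewrite (Cplus_comm a c). apply logistic_intertwines. rewrite Hbeta. ring.
  - intros u. now apply hyp_quad.
  - apply quad_sub.
  - apply triangular_quad.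
Qed.

Lemma formal_pfaff_identity a c beta v : 2 * beta = a + c - 1 -> ~ nonpos_int c -> ~ nonpos_int beta ->
  hyp a c (pw 1 (a - 1) * (pfaff_factor beta * comp pfaff_series v))%fps
  = (pw 1 (c - 1) * (pfaff_factor beta * comp pfaff_series (bridge a c beta v)))%fps.
Proof.
  intros Hbeta Hc Hb. rewrite !fmul_assoc. revert v.
  apply (intertwining_all_parameters a c beta pfaff_series (fun _ b => pw 1 (a - 1) * pfaff_factor b)%fps
    (fun c b => pw 1 (c - 1) * pfaff_factor b)%fps); try assumption.
  1: intros s t Hs Ht; apply (lips_mul (fun _ => pw 1 (a - 1))); [apply lips_const|];
     now apply (lips_comp pfaff_series (fun e => pw 1 (t e))), lips_pw.
  1: intros s t Hs Ht; apply (lips_mul (fun e => pw 1 (s e - 1)));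
     [apply lips_pw, lip_minus; [exact Hs|apply lip_const]|];
     now apply (lips_comp pfaff_series (fun e => pw 1 (t e))), lips_pw.
  clear c beta Hbeta Hc Hb; intros c beta Hbeta Hc Hb Hres.
  apply (intertwining_generic a c beta pfaff_series (pw 1 (a - 1) * pfaff_factor beta)%fps
    (pw 1 (c - 1) * pfaff_factor beta)%fps (quad (a + c) c) (quad (a + c) a)); try assumption.
  - exact pfaff_series_0.
  - simpl. rewrite pfaff_factor_0. ring.
  - simpl. rewrite pfaff_factor_0. ring.
  - intros g. rewrite <- !fmul_assoc. now apply pfaff_intertwines.
  - intros g. rewrite <- !fmul_assoc. rewrite (Cplus_comm a c). apply pfaff_intertwines. rewrite Hbeta. ring.
  - intros u. now apply hyp_quad.
  - apply quad_sub.
  - apply triangular_quad.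
Qed.

(** * Convergence, majorants and uniqueness of expansions *)

Open Scope R_scope.

Notation conv u x l := (is_pseries (K := C_AbsRing) (V := C_NormedModule) u x l).
Definition partial u (x : C) (n : nat) : C := sum_n (fun k => (u k * x ^ k)%C) n.

Lemma partial_0 u x : partial u x 0 = u O.
Proof. unfold partial. rewrite sum_n_C_0. simpl. ring. Qed.
Lemma partial_S u x n : partial u x (S n) = (partial u x n + u (S n) * x ^ S n)%C.
Proof. apply sum_n_C_S. Qed.

Lemma pow_n_Cpow (x : C) n : pow_n (K := C_Ring) x n = (x ^ n)%C.
Proof. induction n as [|n IH]; [reflexivity|]. simpl. now rewrite IH. Qed.

Lemma partial_scal u x n :
  sum_n (fun k => scal (V := C_NormedModule) (pow_n (K := C_AbsRing) x k) (u k)) n = partial u x n.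
Proof.
  apply (sum_n_ext (G := C_AbelianMonoid)). intros k.
  change (pow_n (K := C_Ring) x k * u k = u k * x ^ k)%C. rewrite pow_n_Cpow. ring.
Qed.

Lemma conv_iff u x l : conv u x l <->
  forall eps, 0 < eps -> exists N, forall n, (N <= n)%nat -> Cmod (partial u x n - l)%C < eps.
Proof.
  unfold is_pseries, is_series. split.
  - intros H eps Heps.
    pose proof (proj1 (filterlim_locally_ball_norm (K := C_AbsRing) (U := C_NormedModule) _ _) H) as H'.
    clear H; rename H' into H.
    destruct (H (mkposreal eps Heps)) as [N HN]. exists N; intros n Hn.
    specialize (HN n Hn). unfold ball_norm in HN. rewrite partial_scal in HN. exact HN.
  - intros H. apply (filterlim_locally_ball_norm (K := C_AbsRing) (U := C_NormedModule)). intros eps.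
    destruct (H eps (cond_pos eps)) as [N HN]. exists N; intros n Hn.
    unfold ball_norm. rewrite partial_scal. exact (HN n Hn).
Qed.

Lemma conv_unique u x l m : conv u x l -> conv u x m -> l = m.
Proof. apply (filterlim_locally_unique (F := eventually)). Qed.

Lemma Cminus_zero (x : C) : @eq C (minus (G := C_AbelianGroup) x (RtoC 0)) x.
Proof. change (@eq C (x - 0)%C x). ring. Qed.

Lemma near0_iff (P : C -> Prop) : near0 P <-> exists r, 0 < r /\ forall x, Cmod x < r -> P x.
Proof.
  unfold near0. split.
  - intros [eps H]. exists eps; split; [apply cond_pos|]. intros x Hx. apply H.
    apply (C_NormedModule_mixin_compat1 (RtoC 0) x eps).
    rewrite Cminus_zero. exact Hx.
  - intros (r & Hr & H). exists (mkposreal (r / 2) ltac:(lra)). intros x Hx. apply H.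
    apply (C_NormedModule_mixin_compat2 (RtoC 0) x) in Hx. simpl in Hx.
    rewrite Cminus_zero in Hx.
    assert (sqrt 2 < 2).
    { rewrite <- (sqrt_square 2) at 2 by lra. apply sqrt_lt_1; lra. }
    eapply Rlt_le_trans; [exact Hx|]. apply Rle_trans with (2 * (r / 2)); [|lra].
    apply Rmult_le_compat_r; lra.
Qed.

Lemma near0_and P Q : near0 P -> near0 Q -> near0 (fun x => P x /\ Q x).
Proof. apply filter_and. Qed.
Lemma near0_imp (P Q : C -> Prop) : (forall x, P x -> Q x) -> near0 P -> near0 Q.
Proof. apply filter_imp. Qed.
Lemma near0_here (P : C -> Prop) : near0 P -> P (RtoC 0).
Proof. intros H. apply near0_iff in H as (r & Hr & H). apply H. now rewrite Cmod_0. Qed.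
Lemma near0_disc r : 0 < r -> near0 (fun x => Cmod x < r).
Proof. intros Hr. apply near0_iff. now exists r. Qed.

(** A geometric majorant, that is, a positive radius of convergence. *)
Definition geo u : Prop := exists M rho, 0 <= M /\ 0 < rho /\ forall n, Cmod (u n) <= M * rho ^ n.

Lemma partial_diff u x K t : 0 <= t <= / 2 -> 0 <= K ->
  (forall n, Cmod (u n * x ^ n)%C <= K * t ^ n) ->
  forall N p, Cmod (partial u x (N + p) - partial u x N)%C <= 2 * K * t ^ S N * (1 - (/ 2) ^ p).
Proof.
  intros Ht HK H N p; induction p as [|p IH].
  - rewrite Nat.add_0_r. replace (partial u x N - partial u x N)%C with (RtoC 0) by ring.
    rewrite Cmod_0. simpl. lra.
  - rewrite Nat.add_succ_r, partial_S.
    replace (partial u x (N + p) + u (S (N + p)) * x ^ S (N + p) - partial u x N)%C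
      with ((partial u x (N + p) - partial u x N) + u (S (N + p)) * x ^ S (N + p))%C by ring.
    eapply Rle_trans; [apply Cmod_triangle|].
    specialize (H (S (N + p))).
    assert (E : t ^ S (N + p) <= t ^ S N * (/ 2) ^ p).
    { replace (S (N + p)) with (S N + p)%nat by lia. rewrite pow_add.
      apply Rmult_le_compat_l; [apply pow_le; lra|]. apply pow_incr. lra. }
    assert (K * t ^ S (N + p) <= K * (t ^ S N * (/ 2) ^ p)) by (apply Rmult_le_compat_l; lra).
    change ((/2) ^ S p) with (/ 2 * (/ 2) ^ p).
    lra.
Qed.

(** The tail of a series dominated by [K t^n] with [t <= 1/2] is at most twice its
    first term; all the convergence estimates go through this bound. *)
Lemma conv_tail u x l K t : 0 <= t <= / 2 -> 0 <= K ->
  (forall n, Cmod (u n * x ^ n)%C <= K * t ^ n) -> conv u x l ->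
  forall N, Cmod (l - partial u x N)%C <= 2 * K * t ^ S N.
Proof.
  intros Ht HK H Hl N. apply le_epsilon. intros eps Heps.
  destruct (proj1 (conv_iff u x l) Hl eps Heps) as [N0 HN0].
  specialize (HN0 (N + N0)%nat ltac:(lia)).
  pose proof (partial_diff u x K t Ht HK H N N0) as Hd.
  replace (l - partial u x N)%C
    with ((partial u x (N + N0) - partial u x N) + - (partial u x (N + N0) - l))%C by ring.
  eapply Rle_trans; [apply Cmod_triangle|]. rewrite Cmod_opp.
  assert (0 <= (/ 2) ^ N0) by (apply pow_le; lra).
  assert (0 <= 2 * K * t ^ S N) by (apply Rmult_le_pos; [lra|apply pow_le; lra]).
  assert (2 * K * t ^ S N * (1 - (/ 2) ^ N0) <= 2 * K * t ^ S N).
  { rewrite <- (Rmult_1_r (2 * K * t ^ S N)) at 2. apply Rmult_le_compat_l; lra. }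
  lra.
Qed.

Lemma conv_exists u x K t : 0 <= t <= / 2 -> 0 <= K ->
  (forall n, Cmod (u n * x ^ n)%C <= K * t ^ n) -> exists l, conv u x l.
Proof.
  intros Ht HK H.
  destruct (ex_series_le (K := C_AbsRing) (V := C_CompleteNormedModule)
    (fun k => scal (V := C_NormedModule) (pow_n (K := C_AbsRing) x k) (u k)) (fun n => K * t ^ n)) as [l Hl].
  - intros n. eapply Rle_trans; [|apply (H n)]. right.
    change (norm (scal (V := C_NormedModule) (pow_n (K := C_AbsRing) x n) (u n)))
      with (Cmod (pow_n (K := C_Ring) x n * u n)%C).
    rewrite pow_n_Cpow, Cmult_comm. reflexivity.
  - apply (ex_series_scal_l (K := R_AbsRing) (V := R_NormedModule) K (fun n => t ^ n)). apply ex_series_geom. rewrite Rabs_right; lra.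
  - exists l. exact Hl.
Qed.

Lemma geo_term M rho x u : 0 < rho -> (forall n, Cmod (u n) <= M * rho ^ n) ->
  forall n, Cmod (u n * x ^ n)%C <= M * (rho * Cmod x) ^ n.
Proof.
  intros Hr H n. rewrite Cmod_mult, Cmod_pow, Rpow_mult_distr, <- Rmult_assoc.
  apply Rmult_le_compat_r; [apply pow_le, Cmod_ge_0|apply H].
Qed.

Lemma half_disc rho x : 0 < rho -> Cmod x < / (2 * rho) -> 0 <= rho * Cmod x <= / 2.
Proof.
  intros Hr Hx. pose proof (Cmod_ge_0 x). split; [apply Rmult_le_pos; lra|].
  replace (/ 2) with (rho * / (2 * rho)) by (field; lra). apply Rmult_le_compat_l; lra.
Qed.

Lemma psum_spec u x l : conv u x l -> conv u x (psum u x).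
Proof. intros H. apply (epsilon_spec (inhabits (RtoC 0)) (fun l : C => conv u x l)). now exists l. Qed.

Lemma geo_expansion u : geo u -> has_expansion (psum u) u.
Proof.
  intros (M & rho & HM & Hrho & H). apply near0_iff.
  exists (/ (2 * rho)); split; [apply Rinv_0_lt_compat; lra|]. intros x Hx.
  destruct (conv_exists u x M (rho * Cmod x)) as [l Hl];
    [now apply half_disc|exact HM|now apply geo_term|].
  now apply psum_spec with l.
Qed.

Lemma expansion_geo f u : has_expansion f u -> geo u.
Proof.
  intros H. apply near0_iff in H as (r & Hr & H).
  assert (Ec : Cmod (RtoC (r / 2)) = r / 2) by (rewrite Cmod_R, Rabs_right; lra).
  specialize (H (RtoC (r / 2)) ltac:(lra)).
  destruct (filterlim_bounded (K := C_AbsRing) (V := C_NormedModule)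
    (sum_n (fun k => scal (V := C_NormedModule) (pow_n (K := C_AbsRing) (RtoC (r / 2)) k) (u k)))) as [M HM];
    [now exists (f (RtoC (r / 2)))|].
  assert (HM' : forall n, Cmod (partial u (RtoC (r / 2)) n) <= M).
  { intros n. rewrite <- partial_scal. apply HM. }
  clear HM. set (x := RtoC (r / 2)) in *.
  assert (HM0 : 0 <= M) by (eapply Rle_trans; [apply Cmod_ge_0|apply (HM' O)]).
  exists (2 * M), (/ (r / 2)). repeat split; [lra|apply Rinv_0_lt_compat; lra|].
  intros n.
  assert (Ht : Cmod (u n * x ^ n)%C <= 2 * M).
  { destruct n as [|n].
    - rewrite <- (partial_0 u x) . specialize (HM' O). simpl.
      rewrite Cmult_1_r. lra.
    - replace (u (S n) * x ^ S n)%C with (partial u x (S n) + - partial u x n)%C by (rewrite partial_S; ring).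
      eapply Rle_trans; [apply Cmod_triangle|]. rewrite Cmod_opp.
      pose proof (HM' n). pose proof (HM' (S n)). lra. }
  rewrite Cmod_mult, Cmod_pow, Ec in Ht.
  rewrite pow_inv. apply Rmult_le_reg_r with ((r / 2) ^ n); [apply pow_lt; lra|].
  rewrite Rmult_assoc, Rinv_l, Rmult_1_r; [exact Ht|]. apply pow_nonzero. lra.
Qed.

Lemma expansion_0 f u : has_expansion f u -> f (RtoC 0) = u O.
Proof.
  intros H. apply near0_here in H. cbv beta in H. apply (conv_unique u (RtoC 0)); [exact H|].
  apply (is_pseries_0 (K := C_AbsRing) (V := C_NormedModule) u).
Qed.

Lemma conv_lin u v x l m k : conv u x l -> conv v x m -> conv (u - cst k * v)%fps x (l - k * m)%C.
Proof.
  rewrite !conv_iff. intros Hu Hv eps Heps.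
  assert (Hk : 0 < 1 + Cmod k) by (pose proof (Cmod_ge_0 k); lra).
  destruct (Hu (eps / 2) ltac:(lra)) as [N1 H1].
  destruct (Hv (eps / 2 / (1 + Cmod k))) as [N2 H2]; [apply Rdiv_lt_0_compat; lra|].
  exists (N1 + N2)%nat. intros n Hn.
  assert (E : partial (u - cst k * v)%fps x n = (partial u x n - k * partial v x n)%C).
  { induction n as [|n IH] in |- *.
    - rewrite !partial_0. unfold fsub. now rewrite fmul_cst.
    - rewrite !partial_S, IH. unfold fsub. rewrite fmul_cst. ring. }
  rewrite E.
  replace (partial u x n - k * partial v x n - (l - k * m))%C
    with ((partial u x n - l) + - (k * (partial v x n - m)))%C by ring.
  eapply Rle_lt_trans; [apply Cmod_triangle|]. rewrite Cmod_opp, Cmod_mult.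
  specialize (H1 n ltac:(lia)). specialize (H2 n ltac:(lia)).
  pose proof (Cmod_ge_0 k). pose proof (Cmod_ge_0 (partial v x n - m)%C).
  assert (Cmod k * Cmod (partial v x n - m)%C <= eps / 2); [|lra].
  apply Rle_trans with ((1 + Cmod k) * (eps / 2 / (1 + Cmod k))).
  - apply Rmult_le_compat; lra.
  - right. field. lra.
Qed.

Lemma expansion_ext f g u : germ_eq f g -> has_expansion g u -> has_expansion f u.
Proof.
  intros H1 H2. refine (near0_imp _ _ _ (near0_and _ _ H1 H2)).
  intros x [E H]. rewrite E. exact H.
Qed.

Lemma expansion_germ_eq f g u : has_expansion f u -> has_expansion g u -> germ_eq f g.
Proof.
  intros H1 H2. refine (near0_imp _ _ _ (near0_and _ _ H1 H2)).
  intros x [Ha Hb]. now apply (conv_unique u x).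
Qed.

Lemma expansion_lin f g u v k : has_expansion f u -> has_expansion g v ->
  has_expansion (fun x => f x - k * g x)%C (u - cst k * v)%fps.
Proof.
  intros H1 H2. refine (near0_imp _ _ _ (near0_and _ _ H1 H2)).
  intros x [Ha Hb]. now apply conv_lin.
Qed.

(** Used to keep the values of an inner function inside a small disc. *)
Lemma expansion_lipschitz f u : has_expansion f u ->
  exists K, 0 <= K /\ near0 (fun x => Cmod (f x - u O)%C <= K * Cmod x).
Proof.
  intros H. destruct (expansion_geo f u H) as (M & rho & HM & Hrho & Hg).
  exists (2 * M * rho); split; [repeat apply Rmult_le_pos; lra|].
  refine (near0_imp _ _ _ (near0_and _ _ H (near0_disc (/ (2 * rho)) _))).
  2: apply Rinv_0_lt_compat; lra.
  intros x [Hc Hx]. pose proof (conv_tail u x (f x) M (rho * Cmod x) (half_disc _ _ Hrho Hx) HM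
    (geo_term M rho x u Hrho Hg) Hc 0) as E.
  rewrite partial_0 in E. simpl in E. lra.
Qed.

(** Were [u n] the first nonzero coefficient, the tail bound would give
    [Cmod (u n) <= C0 * Cmod x] for all small [x]. *)
Lemma expansion_zero u : has_expansion (fun _ => RtoC 0) u -> u = cst 0.
Proof.
  intros H. destruct (expansion_geo _ u H) as (M & rho & HM & Hrho & Hg).
  assert (Hb : forall n, below n u).
  { induction n as [|n IH]; [intros k Hk; lia|].
    intros k Hk. destruct (Nat.eq_dec k n) as [->|]; [|apply IH; lia].
    destruct (Ceq_dec (u n) 0) as [E|E]; [exact E|exfalso].
    set (m := Cmod (u n)). assert (Hm : 0 < m) by now apply Cmod_gt_0.
    apply near0_iff in H as (r & Hr & H).
    set (C0 := 2 * M * rho ^ S n).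
    assert (HC : 0 <= C0) by (apply Rmult_le_pos; [lra|apply pow_le; lra]).
    assert (Hinv : 0 < / (2 * rho)) by (apply Rinv_0_lt_compat; lra).
    assert (Hq : 0 < m / (2 * (C0 + 1))) by (apply Rdiv_lt_0_compat; lra).
    (* A positive real point inside both discs, small enough to contradict the tail bound. *)
    set (t := Rmin (Rmin r (/ (2 * rho)) / 2) (m / (2 * (C0 + 1)))).
    pose proof (Rmin_l r (/ (2 * rho))). pose proof (Rmin_r r (/ (2 * rho))).
    assert (0 < Rmin r (/ (2 * rho))) by now apply Rmin_pos.
    assert (Ht : 0 < t) by (apply Rmin_pos; lra).
    assert (Ht1 : t <= Rmin r (/ (2 * rho)) / 2) by apply Rmin_l.
    assert (Ht2 : t <= m / (2 * (C0 + 1))) by apply Rmin_r.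
    assert (Et : Cmod (RtoC t) = t) by (rewrite Cmod_R, Rabs_right; lra).
    pose proof (conv_tail u t (RtoC 0) M (rho * Cmod t) (half_disc rho t Hrho ltac:(lra)) HM
      (geo_term M rho t u Hrho Hg) (H t ltac:(lra)) n) as T.
    assert (Es : partial u (RtoC t) n = (u n * t ^ n)%C).
    { destruct n as [|n]; [rewrite partial_0; simpl; ring|].
      rewrite partial_S. unfold partial. rewrite sum_n_C_zero; [ring|].
      intros j Hj. rewrite IH by lia. ring. }
    rewrite Es in T. replace (0 - u n * t ^ n)%C with (- (u n * t ^ n))%C in T by ring.
    rewrite Cmod_opp, Cmod_mult, Cmod_pow, Et, Rpow_mult_distr in T. fold m in T.
    assert (T' : m * t ^ n <= C0 * t * t ^ n) by (unfold C0; simpl in T |- *; lra).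
    apply Rmult_le_reg_r in T'; [|now apply pow_lt].
    assert (C0 * t <= C0 * (m / (2 * (C0 + 1)))) by (apply Rmult_le_compat_l; lra).
    assert (C0 * (m / (2 * (C0 + 1))) < m); [|lra].
    apply Rmult_lt_reg_r with (2 * (C0 + 1)); [lra|].
    replace (C0 * (m / (2 * (C0 + 1))) * (2 * (C0 + 1))) with (C0 * m) by (field; lra).
    assert (0 <= C0 * m) by (apply Rmult_le_pos; lra). lra. }
  apply fps_ext; intros n. transitivity (RtoC 0); [apply (Hb (S n)); lia|now destruct n].
Qed.

Lemma expansion_unique f g u v : germ_eq f g -> has_expansion f u -> has_expansion g v -> u = v.
Proof.
  intros E Hf Hg.
  assert (H : (u - cst 1 * v)%fps = cst 0).
  { apply expansion_zero. refine (near0_imp _ _ _ (near0_and _ _ E (expansion_lin f g u v 1 Hf Hg))).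
    intros x [Ex Hx]. rewrite Ex in Hx. replace (RtoC 0) with (g x - 1 * g x)%C by ring. exact Hx. }
  transitivity (u - cst 1 * v + v)%fps; [ring|]. rewrite H. ring.
Qed.

(** * Products and compositions of expansions *)

Open Scope R_scope.

Lemma partial_triangle (A : nat -> fps) x N : (forall k n, (n < k)%nat -> A k n = RtoC 0) ->
  partial (fun n => sum_n (fun k => A k n) n) x N = sum_n (fun k => partial (A k) x N) N.
Proof.
  intros HA; induction N as [|N IH].
  - now rewrite partial_0, !sum_n_C_0, partial_0.
  - rewrite partial_S, IH. rewrite !sum_n_C_S.
    assert (E : forall n, sum_n (fun k => partial (A k) x (S N)) n
      = (sum_n (fun k => partial (A k) x N) n + sum_n (fun k => A k (S N)) n * x ^ S N)%C).
    { induction n as [|n IHn]; [rewrite !sum_n_C_0; apply partial_S|].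
      rewrite !sum_n_C_S, IHn, partial_S. Cring. }
    rewrite E, partial_S.
    assert (E0 : partial (A (S N)) x N = RtoC 0).
    { apply sum_n_C_zero. intros k Hk. rewrite HA by lia. ring. }
    rewrite E0. Cring.
Qed.

Lemma Cmod_sum_n_le (f : nat -> C) K n : 0 <= K -> (forall k, Cmod (f k) <= K * (/ 2) ^ k) ->
  Cmod (sum_n f n) <= 2 * K * (1 - (/ 2) ^ S n).
Proof.
  intros HK H; induction n as [|n IH].
  - rewrite sum_n_C_0. specialize (H O). simpl in *. lra.
  - rewrite sum_n_C_S. eapply Rle_trans; [apply Cmod_triangle|].
    specialize (H (S n)). change ((/ 2) ^ S (S n)) with (/ 2 * (/ 2) ^ S n). lra.
Qed.

(** Summing a triangular array by columns gives the sum by rows, provided that its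
    entries decay geometrically in both directions.  The product of two series is
    the case [A k = u_k x^k v], and the composition is the case [A k = v_k y^k]. *)
Lemma double_series (A : nat -> fps) (F : nat -> C) (s x : C) M t :
  0 <= t <= / 2 -> 0 <= M ->
  (forall k n, Cmod (A k n * x ^ n)%C <= M * (/ 2) ^ k * t ^ n) ->
  (forall k n, (n < k)%nat -> A k n = RtoC 0) ->
  (forall k, conv (A k) x (F k)) ->
  (forall eps, 0 < eps -> exists N, forall n, (N <= n)%nat -> Cmod (sum_n F n - s)%C < eps) ->
  conv (fun n => sum_n (fun k => A k n) n) x s.
Proof.
  intros Ht HM Hbd HA Hconv Hs. apply conv_iff. intros eps Heps.
  destruct (Hs (eps / 2) ltac:(lra)) as [N1 H1].
  destruct (pow_lt_1_zero (/ 2) ltac:(rewrite Rabs_right; lra) (eps / 2 / (4 * (M + 1)))) as [N2 H2];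
    [apply Rdiv_lt_0_compat; lra|].
  exists (N1 + N2)%nat. intros n Hn. specialize (H1 n ltac:(lia)). specialize (H2 n ltac:(lia)).
  assert (Hp : 0 <= (/ 2) ^ n) by (apply pow_le; lra).
  rewrite Rabs_right in H2 by lra.
  rewrite partial_triangle by exact HA.
  assert (E : forall m, (sum_n (fun k => partial (A k) x n) m
    = sum_n F m + - sum_n (fun k => F k - partial (A k) x n) m)%C).
  { induction m as [|m IHm]; [rewrite !sum_n_C_0; Cring|]. rewrite !sum_n_C_S, IHm. Cring. }
  rewrite E.
  replace (sum_n F n + - sum_n (fun k => F k - partial (A k) x n) n - s)%C
    with ((sum_n F n - s) + - sum_n (fun k => F k - partial (A k) x n) n)%C by Cring.
  eapply Rle_lt_trans; [apply Cmod_triangle|]. rewrite Cmod_opp.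
  assert (Hsum : Cmod (sum_n (fun k => F k - partial (A k) x n)%C n)
    <= 2 * (2 * M * t ^ S n) * (1 - (/ 2) ^ S n)).
  { apply Cmod_sum_n_le.
    - apply Rmult_le_pos; [lra|apply pow_le; lra].
    - intros k. replace (2 * M * t ^ S n * (/ 2) ^ k) with (2 * (M * (/ 2) ^ k) * t ^ S n) by ring.
      apply (conv_tail (A k) x (F k) (M * (/ 2) ^ k) t Ht); [|apply Hbd|apply Hconv].
      apply Rmult_le_pos; [exact HM|apply pow_le; lra]. }
  assert (Htn : t ^ S n <= (/ 2) ^ n).
  { apply Rle_trans with ((/ 2) ^ S n); [apply pow_incr; lra|]. simpl. lra. }
  assert (H4 : 2 * (2 * M * t ^ S n) * (1 - (/ 2) ^ S n) <= 4 * M * (/ 2) ^ n).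
  { assert (0 <= (/ 2) ^ S n) by (apply pow_le; lra).
    assert (0 <= t ^ S n) by (apply pow_le; lra).
    assert (0 <= M * t ^ S n) by now apply Rmult_le_pos.
    apply Rle_trans with (4 * (M * t ^ S n)).
    - rewrite <- (Rmult_1_r (4 * (M * t ^ S n))).
      replace (2 * (2 * M * t ^ S n)) with (4 * (M * t ^ S n)) by ring.
      apply Rmult_le_compat_l; lra.
    - rewrite Rmult_assoc. apply Rmult_le_compat_l; [lra|]. now apply Rmult_le_compat_l. }
  assert (H5 : 4 * M * (/ 2) ^ n <= 4 * (M + 1) * (/ 2) ^ n) by (apply Rmult_le_compat_r; lra).
  assert (H6 : 4 * (M + 1) * (/ 2) ^ n < eps / 2).
  { apply Rmult_lt_reg_r with (/ (4 * (M + 1))); [apply Rinv_0_lt_compat; lra|].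
    replace (4 * (M + 1) * (/ 2) ^ n * / (4 * (M + 1))) with ((/ 2) ^ n) by (field; lra).
    exact H2. }
  lra.
Qed.

Fixpoint shift (k : nat) (v : fps) : fps := match k with O => v | S j => (X * shift j v)%fps end.

Lemma shift_below k v n : (n < k)%nat -> shift k v n = RtoC 0.
Proof.
  revert n; induction k as [|k IH]; intros [|n] H; try lia; change (shift (S k) v) with (X * shift k v)%fps.
  - apply fmul_X_0.
  - rewrite fmul_X_S. apply IH. lia.
Qed.

Lemma shift_above k v n : shift k v (k + n)%nat = v n.
Proof.
  induction k as [|k IH]; [reflexivity|].
  change (shift (S k) v) with (X * shift k v)%fps. change (S k + n)%nat with (S (k + n)). now rewrite fmul_X_S.
Qed.

Lemma fmul_shift u v n : fmul u v n = sum_n (fun k => u k * shift k v n)%C n.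
Proof.
  revert u; induction n as [|n IH]; intros u; [now rewrite sum_n_C_0|].
  rewrite sum_n_C_shift. simpl fmul. rewrite IH.
  apply (f_equal (Cplus (u O * v (S n))%C)).
  apply sum_n_ext. intros k. change (shift (S k) v) with (X * shift k v)%fps. now rewrite fmul_X_S.
Qed.

Lemma conv_X v (x l : C) : conv v x l -> conv (X * v)%fps x (x * l)%C.
Proof.
  intros H. replace (X * v)%fps with (PS_incr_1 (V := C_NormedModule) v).
  - exact (is_pseries_incr_1 (K := C_AbsRing) (V := C_NormedModule) v x l H).
  - apply fps_ext; intros [|n]; [now rewrite fmul_X_0|now rewrite fmul_X_S].
Qed.

Lemma conv_cst_mul v (x l k : C) : conv v x l -> conv (cst k * v)%fps x (k * l)%C.
Proof.
  intros H.
  pose proof (conv_lin v v x l l 1%C H H) as H0.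
  pose proof (conv_lin _ v x _ l (- k)%C H0 H) as H1.
  replace (k * l)%C with (l - 1 * l - - k * l)%C by ring.
  replace (cst k * v)%fps with (v - cst 1 * v - cst (- k) * v)%fps; [exact H1|].
  rewrite cst_opp. ring.
Qed.

Lemma conv_shift k v (x l : C) : conv v x l -> conv (shift k v) x (x ^ k * l)%C.
Proof.
  intros H; induction k as [|k IH]; simpl.
  - now replace (1 * l)%C with l by ring.
  - replace (x * x ^ k * l)%C with (x * (x ^ k * l))%C by ring. now apply conv_X.
Qed.

(** Stated at one point and with explicit majorants: powers [y^k] must converge
    on a disc that does not depend on [k], which the statement for germs alone would
    not give. *)
Lemma conv_mul u v (x l m : C) (M1 r1 M2 r2 r : R) :
  0 <= M1 -> 0 <= M2 -> 0 <= r1 -> 0 <= r2 -> 2 * r1 <= r -> r2 <= r -> r * Cmod x <= / 2 ->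
  (forall n, Cmod (u n) <= M1 * r1 ^ n) -> (forall n, Cmod (v n) <= M2 * r2 ^ n) ->
  conv u x l -> conv v x m -> conv (u * v)%fps x (l * m)%C.
Proof.
  intros HM1 HM2 Hr1 Hr2 Hr1r Hr2r Hx Hu Hv Hl Hm.
  replace (u * v)%fps with (fun n => sum_n (fun k => (cst (u k) * shift k v)%fps n) n).
  2:{ apply fps_ext; intros n. rewrite fmul_shift. apply sum_n_ext; intros k. apply fmul_cst. }
  pose proof (Cmod_ge_0 x) as Hx0.
  apply (double_series _ (fun k => u k * (x ^ k * m))%C _ _ (M1 * M2) (r * Cmod x)).
  - split; [apply Rmult_le_pos; lra|exact Hx].
  - now apply Rmult_le_pos.
  - intros k n. rewrite fmul_cst.
    assert (Ht : 0 <= r * Cmod x) by (apply Rmult_le_pos; lra).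
    destruct (Nat.lt_ge_cases n k) as [Hnk|Hnk].
    + rewrite shift_below by exact Hnk. replace (u k * 0 * x ^ n)%C with (RtoC 0) by ring.
      rewrite Cmod_0. repeat apply Rmult_le_pos; try assumption; apply pow_le; lra.
    + replace n with (k + (n - k))%nat by lia. set (j := (n - k)%nat).
      rewrite shift_above, !Cmod_mult, Cmod_pow, !pow_add.
      replace (M1 * M2 * (/ 2) ^ k * ((r * Cmod x) ^ k * (r * Cmod x) ^ j))
        with ((M1 * ((/ 2 * r) ^ k)) * (M2 * r ^ j) * (Cmod x ^ k * Cmod x ^ j))
        by (rewrite !Rpow_mult_distr; ring).
      apply Rmult_le_compat_r; [apply Rmult_le_pos; apply pow_le; lra|].
      apply Rmult_le_compat; try apply Cmod_ge_0.
      * eapply Rle_trans; [apply Hu|]. apply Rmult_le_compat_l; [lra|]. apply pow_incr. lra.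
      * eapply Rle_trans; [apply Hv|]. apply Rmult_le_compat_l; [lra|]. apply pow_incr. lra.
  - intros k n Hnk. rewrite fmul_cst, shift_below by exact Hnk. ring.
  - intros k. now apply conv_cst_mul, conv_shift.
  - intros eps Heps. pose proof (Cmod_ge_0 m).
    destruct (proj1 (conv_iff u x l) Hl (eps / (1 + Cmod m))) as [N HN];
      [apply Rdiv_lt_0_compat; lra|].
    exists N. intros n Hn. specialize (HN n Hn).
    assert (E : (sum_n (fun k => u k * (x ^ k * m)) n = partial u x n * m)%C).
    { clear Hn HN. induction n as [|n IH]; [rewrite sum_n_C_0, partial_0; simpl; Cring|].
      rewrite sum_n_C_S, IH, partial_S. Cring. }
    rewrite E. replace (partial u x n * m - l * m)%C with ((partial u x n - l) * m)%C by ring.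
    rewrite Cmod_mult. pose proof (Cmod_ge_0 (partial u x n - l)%C).
    apply Rle_lt_trans with (Cmod (partial u x n - l)%C * (1 + Cmod m)); [apply Rmult_le_compat_l; lra|].
    apply Rmult_lt_reg_r with (/ (1 + Cmod m)); [apply Rinv_0_lt_compat; lra|].
    rewrite Rmult_assoc, Rinv_r, Rmult_1_r by lra. exact HN.
Qed.

Lemma expansion_mul f g u v : has_expansion f u -> has_expansion g v ->
  has_expansion (fun x => f x * g x)%C (u * v)%fps.
Proof.
  intros Hf Hg.
  destruct (expansion_geo f u Hf) as (M1 & r1 & HM1 & Hr1 & Hu).
  destruct (expansion_geo g v Hg) as (M2 & r2 & HM2 & Hr2 & Hv).
  set (r := 2 * r1 + r2).
  refine (near0_imp _ _ _ (near0_and _ _ (near0_and _ _ Hf Hg) (near0_disc (/ (2 * r)) _))).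
  2: apply Rinv_0_lt_compat; unfold r; lra.
  intros x [[Hl Hm] Hx].
  apply (conv_mul u v x (f x) (g x) M1 r1 M2 r2 r); try assumption; unfold r; try lra.
  apply (half_disc r); [unfold r; lra|exact Hx].
Qed.

Lemma fmul_bound u v M K r : 0 <= M -> 0 <= K -> 0 <= r ->
  (forall n, Cmod (u n) <= M * r ^ n) -> (forall n, Cmod (v n) <= K * (2 * r) ^ n) ->
  forall n, Cmod (fmul u v n) <= 2 * M * K * (2 * r) ^ n.
Proof.
  intros HM HK Hr Hu Hv n. revert u M HM Hu; induction n as [|n IH]; intros u M HM Hu.
  - simpl. rewrite Cmod_mult. specialize (Hu O). specialize (Hv O). simpl in *.
    assert (Cmod (u O) * Cmod (v O) <= M * K) by (apply Rmult_le_compat; try apply Cmod_ge_0; lra).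
    assert (0 <= M * K) by now apply Rmult_le_pos. lra.
  - simpl fmul. eapply Rle_trans; [apply Cmod_triangle|]. rewrite Cmod_mult.
    assert (H1 : Cmod (u O) * Cmod (v (S n)) <= M * (K * (2 * r) ^ S n)).
    { apply Rmult_le_compat; try apply Cmod_ge_0; [|apply Hv]. specialize (Hu O). simpl in Hu. lra. }
    assert (H2 : Cmod (fmul (tl u) v n) <= 2 * (M * r) * K * (2 * r) ^ n).
    { apply IH; [now apply Rmult_le_pos|]. intros k. unfold tl. specialize (Hu (S k)).
      simpl in Hu. lra. }
    simpl pow in H1 |- *. lra.
Qed.

(** Because [u 0 = 0] the constant is [M K], without a factor 2, and it can be
    iterated in [fpow_bound]. *)
Lemma fmul_bound_0 u v M K r : 0 <= M -> 0 <= K -> 0 <= r -> u O = RtoC 0 ->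
  (forall n, Cmod (u n) <= M * r ^ n) -> (forall n, Cmod (v n) <= K * (2 * r) ^ n) ->
  forall n, Cmod (fmul u v n) <= M * K * (2 * r) ^ n.
Proof.
  intros HM HK Hr Hu0 Hu Hv [|n].
  - simpl. rewrite Hu0. replace (0 * v O)%C with (RtoC 0) by ring. rewrite Cmod_0.
    assert (0 <= M * K) by now apply Rmult_le_pos. lra.
  - simpl fmul. rewrite Hu0. replace (0 * v (S n) + fmul (tl u) v n)%C with (fmul (tl u) v n) by ring.
    replace (M * K * (2 * r) ^ S n) with (2 * (M * r) * K * (2 * r) ^ n) by (simpl; ring).
    apply fmul_bound; try assumption; [now apply Rmult_le_pos|].
    intros k. unfold tl. specialize (Hu (S k)). simpl in Hu. lra.
Qed.

Lemma fpow_bound y m r : 0 <= m -> 0 <= r -> y O = RtoC 0 -> (forall n, Cmod (y n) <= m * r ^ n) ->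
  forall k n, Cmod (fpow y k n) <= m ^ k * (2 * r) ^ n.
Proof.
  intros Hm Hr Hy0 Hy k; induction k as [|k IH]; intros n.
  - simpl fpow. assert (0 <= (2 * r) ^ n) by (apply pow_le; lra).
    destruct n; simpl cst; [rewrite Cmod_1|rewrite Cmod_0]; simpl in *; lra.
  - apply (fmul_bound_0 y (fpow y k) m (m ^ k) r); try assumption. now apply pow_le.
Qed.

(** For a series vanishing at 0 the constant of the majorant may be traded against
    the ratio: it can be made as small as desired. *)
Lemma geo_rescale y m : geo y -> y O = RtoC 0 -> 0 < m ->
  exists r, 0 < r /\ forall n, Cmod (y n) <= m * r ^ n.
Proof.
  intros (M & rho & HM & Hrho & H) Hy0 Hm.
  (* [lam >= 1] and [m * lam >= M], and from degree 1 on one factor [lam] is available. *)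
  set (lam := 1 + M / m).
  assert (HMm : 0 <= M / m) by (apply Rdiv_le_0_compat; lra).
  exists (lam * rho); split; [apply Rmult_lt_0_compat; unfold lam; lra|].
  intros [|n]; [rewrite Hy0, Cmod_0; simpl; lra|].
  eapply Rle_trans; [apply H|]. rewrite Rpow_mult_distr, <- Rmult_assoc.
  apply Rmult_le_compat_r; [apply pow_le; lra|].
  assert (1 <= lam ^ n) by (apply pow_R1_Rle; unfold lam; lra).
  simpl. apply Rle_trans with (m * (lam * 1)).
  - unfold lam. replace (m * ((1 + M / m) * 1)) with (m + M) by (field; lra). lra.
  - apply Rmult_le_compat_l; [lra|]. apply Rmult_le_compat_l; [unfold lam; lra|assumption].
Qed.

(** With the majorant of the inner series rescaled to the constant
    [1 / (2 rho)], where [rho] is the ratio for the outer one, the coefficients of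
    [v_k y^k] decay like [2^(-k)]. *)
Lemma expansion_comp g f v y : has_expansion g v -> has_expansion f y -> y O = RtoC 0 ->
  has_expansion (fun x => g (f x)) (comp y v).
Proof.
  intros Hg Hf Hy0.
  destruct (expansion_geo g v Hg) as (M & rho & HM & Hrho & Hv).
  assert (Hm : 0 < / (2 * rho)) by (apply Rinv_0_lt_compat; lra).
  destruct (geo_rescale y (/ (2 * rho)) (expansion_geo f y Hf) Hy0 Hm) as (r & Hr & Hy).
  assert (Hgf : near0 (fun x => conv v (f x) (g (f x)))).
  { destruct (expansion_lipschitz f y Hf) as (K & HK & Hlip).
    apply near0_iff in Hg as (s & Hs & Hg).
    refine (near0_imp _ _ _ (near0_and _ _ Hlip (near0_disc (s / (K + 1)) _))).
    2: apply Rdiv_lt_0_compat; lra.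
    intros x [H1 H2]. apply Hg. rewrite Hy0 in H1. replace (f x - 0)%C with (f x) in H1 by ring.
    eapply Rle_lt_trans; [exact H1|].
    apply Rle_lt_trans with ((K + 1) * Cmod x); [apply Rmult_le_compat_r; [apply Cmod_ge_0|lra]|].
    apply Rmult_lt_compat_l with (r := K + 1) in H2; [|lra].
    replace ((K + 1) * (s / (K + 1))) with s in H2 by (field; lra). exact H2. }
  refine (near0_imp _ _ _ (near0_and _ _ (near0_and _ _ Hf Hgf) (near0_disc (/ (2 * (2 * r))) _))).
  2: apply Rinv_0_lt_compat; lra.
  intros x [[Hfx Hgx] Hx].
  pose proof (half_disc (2 * r) x ltac:(lra) Hx) as Ht.
  replace (comp y v) with (fun n => sum_n (fun k => (cst (v k) * fpow y k)%fps n) n).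
  2:{ apply fps_ext; intros n. apply sum_n_ext; intros k. apply fmul_cst. }
  apply (double_series _ (fun k => v k * f x ^ k)%C _ _ M (2 * r * Cmod x) Ht HM).
  - intros k n. rewrite fmul_cst, !Cmod_mult, Cmod_pow, Rpow_mult_distr.
    rewrite <- Rmult_assoc. apply Rmult_le_compat_r; [apply pow_le, Cmod_ge_0|].
    apply Rle_trans with ((M * rho ^ k) * ((/ (2 * rho)) ^ k * (2 * r) ^ n)).
    + apply Rmult_le_compat; try apply Cmod_ge_0; [apply Hv|].
      apply fpow_bound; try assumption; lra.
    + right. replace (/ (2 * rho)) with (/ 2 * / rho) by (field; lra).
      rewrite Rpow_mult_distr, (pow_inv rho). field. apply pow_nonzero. lra.
  - intros k n Hnk. rewrite fmul_cst. rewrite (proj1 (fpow_below y Hy0 k) n Hnk). ring.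
  - intros k. apply conv_cst_mul. induction k as [|k IH].
    + simpl. apply conv_iff. intros eps Heps. exists O. intros n _.
      replace (partial (cst 1) x n) with (RtoC 1).
      * replace (1 - 1)%C with (RtoC 0) by ring. now rewrite Cmod_0.
      * symmetry. induction n as [|n IHn]; [apply partial_0|]. rewrite partial_S, IHn. simpl. ring.
    + simpl. apply (conv_mul y (fpow y k) x (f x) (f x ^ k)%C (/ (2 * rho)) r ((/ (2 * rho)) ^ k) (2 * r) (2 * r));
        try assumption; try lra.
      * apply pow_le. lra.
      * apply fpow_bound; try assumption; lra.
  - apply conv_iff. exact Hgx.
Qed.

(** * Expansion of complex powers *)

Open Scope R_scope.

(** Derivative of a complex function of a real variable, by components. *)
Definition cder (F : R -> C) (t : R) (l : C) : Prop :=
  is_derive (fun s => Re (F s)) t (Re l) /\ is_derive (fun s => Im (F s)) t (Im l).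

Lemma cder_mul F G t l m : cder F t l -> cder G t m ->
  cder (fun s => (F s * G s)%C) t (l * G t + F t * m)%C.
Proof.
  intros [F1 F2] [G1 G2]. split.
  - evar_last.
    + apply (is_derive_minus (fun s => Re (F s) * Re (G s)) (fun s => Im (F s) * Im (G s))).
      * apply (is_derive_mult (fun s => Re (F s)) (fun s => Re (G s)) t _ _ F1 G1). intros; apply Rmult_comm.
      * apply (is_derive_mult (fun s => Im (F s)) (fun s => Im (G s)) t _ _ F2 G2). intros; apply Rmult_comm.
    + unfold minus, plus, opp, mult, Re, Im; simpl. ring.
  - evar_last.
    + apply (is_derive_plus (fun s => Re (F s) * Im (G s)) (fun s => Im (F s) * Re (G s))).
      * apply (is_derive_mult (fun s => Re (F s)) (fun s => Im (G s)) t _ _ F1 G2). intros; apply Rmult_comm.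
      * apply (is_derive_mult (fun s => Im (F s)) (fun s => Re (G s)) t _ _ F2 G1). intros; apply Rmult_comm.
    + unfold minus, plus, opp, mult, Re, Im; simpl. ring.
Qed.

Lemma cder_const k t : cder (fun _ => k) t 0%C.
Proof. split; apply (is_derive_const (K := R_AbsRing) (V := R_NormedModule)). Qed.

Lemma cder_scal k F t l : cder F t l -> cder (fun s => (k * F s)%C) t (k * l)%C.
Proof.
  intros H. pose proof (cder_mul (fun _ => k) F t 0%C l (cder_const k t) H) as E.
  cbv beta in E. replace (k * l)%C with (0 * F t + k * l)%C by ring. exact E.
Qed.

Lemma cder_exp F t l : cder F t l -> cder (fun s => Cexp (F s)) t (l * Cexp (F t))%C.
Proof.
  intros [F1 F2].
  assert (He : is_derive (fun s => exp (Re (F s))) t (Re l * exp (Re (F t)))).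
  { evar_last; [apply (is_derive_comp exp (fun s => Re (F s)) t); [apply is_derive_exp|exact F1]|].
    unfold scal; simpl; unfold mult; simpl. ring. }
  assert (Hc : is_derive (fun s => cos (Im (F s))) t (- (Im l * sin (Im (F t))))).
  { evar_last; [apply (is_derive_comp cos (fun s => Im (F s)) t); [apply is_derive_cos|exact F2]|].
    unfold scal; simpl; unfold mult; simpl. ring. }
  assert (Hs : is_derive (fun s => sin (Im (F s))) t (Im l * cos (Im (F t)))).
  { evar_last; [apply (is_derive_comp sin (fun s => Im (F s)) t); [apply is_derive_sin|exact F2]|].
    unfold scal; simpl; unfold mult; simpl. ring. }
  split; simpl.
  - evar_last.
    + apply (is_derive_mult (fun s => exp (Re (F s))) (fun s => cos (Im (F s))) t _ _ He Hc). intros; apply Rmult_comm.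
    + unfold plus, mult, Re, Im; simpl. ring.
  - evar_last.
    + apply (is_derive_mult (fun s => exp (Re (F s))) (fun s => sin (Im (F s))) t _ _ He Hs). intros; apply Rmult_comm.
    + unfold plus, mult, Re, Im; simpl. ring.
Qed.

Lemma cder_zero F : (forall t, 0 <= t <= 1 -> cder F t 0%C) -> F 0 = F 1.
Proof.
  intros H. apply injective_projections.
  - apply (eq_is_derive (fun s => Re (F s)) 0 1); [|lra]. intros t Ht. exact (proj1 (H t Ht)).
  - apply (eq_is_derive (fun s => Im (F s)) 0 1); [|lra]. intros t Ht. exact (proj2 (H t Ht)).
Qed.

Lemma Cexp_add z z' : (Cexp (z + z') = Cexp z * Cexp z')%C.
Proof.
  unfold Cexp. apply injective_projections; simpl; rewrite exp_plus.
  - rewrite cos_plus. unfold Re, Im. ring.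
  - rewrite sin_plus. unfold Re, Im. ring.
Qed.

Lemma Cexp_0 : Cexp 0 = RtoC 1.
Proof. unfold Cexp. simpl. rewrite exp_0, cos_0, sin_0. apply injective_projections; simpl; ring. Qed.

Lemma Clog_1 : Clog 1 = RtoC 0.
Proof.
  unfold Clog, Carg. rewrite Cmod_1, ln_1. simpl.
  replace (0 / (1 + 1)) with 0 by field. rewrite atan_0. apply injective_projections; simpl; ring.
Qed.

(** The principal logarithm along a line in the right half-plane.  Its imaginary
    part is differentiated through the half-angle formula that defines the
    argument. *)
Lemma cder_log_line (z : C) t : 0 < 1 + t * Re z ->
  cder (fun s => Clog (1 + RtoC s * z)%C) t (z / (1 + RtoC t * z))%C.
Proof.
  destruct z as [p q]. simpl Re. intros Hu.
  set (u := 1 + t * p) in *. set (v := t * q).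
  assert (Hm : forall s, Cmod (1 + RtoC s * (p, q))%C = sqrt ((1 + s * p) * (1 + s * p) + s * q * (s * q))).
  { intros s. unfold Cmod. f_equal. simpl. ring. }
  assert (Hpos : 0 < u * u + v * v).
  { apply Rplus_lt_le_0_compat; [now apply Rmult_lt_0_compat|apply Rle_0_sqr]. }
  set (r := sqrt (u * u + v * v)).
  assert (Hr : 0 < r) by now apply sqrt_lt_R0.
  assert (Hrr : r * r = u * u + v * v) by (apply sqrt_sqrt; lra).
  assert (Ew : (1 + RtoC t * (p, q))%C = (u, v)).
  { apply injective_projections; simpl; unfold u, v; ring. }
  assert (Ez : ((p, q) / (u, v))%C = ((p * u + q * v) / (r * r), (q * u - p * v) / (r * r))).
  { rewrite Hrr. apply injective_projections; simpl; field; lra. }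
  rewrite Ew, Ez. split; simpl.
  - apply (is_derive_ext (fun s => ln (sqrt ((1 + s * p) * (1 + s * p) + s * q * (s * q))))).
    { intros s. now rewrite <- Hm. }
    auto_derive.
    + fold u v. fold r. repeat split; lra.
    + fold u v. fold r. field. lra.
  - apply (is_derive_ext (fun s => 2 * atan (s * q /
      (sqrt ((1 + s * p) * (1 + s * p) + s * q * (s * q)) + (1 + s * p))))).
    { intros s. unfold Carg. rewrite Hm. simpl. do 3 f_equal; ring_simplify; reflexivity. }
    auto_derive.
    + fold u v. fold r. repeat split; lra.
    + fold u v. fold r.
      assert (Hv : v * v = r * r - u * u) by lra.
      (* [(r + u)^2 + v^2 = 2 r (r + u)], since [r^2 = u^2 + v^2]. *)
      assert (E : 1 + v * / (r + u) * (v * / (r + u) * 1) = 2 * r / (r + u)).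
      { transitivity (1 + v * v / ((r + u) * (r + u))); [field; lra|]. rewrite Hv. field. lra. }
      rewrite E.
      transitivity ((q * r * (r + u) - q * (v * v) - v * p * (u + r)) / (r * r * (r + u))).
      * field. lra.
      * rewrite Hv. field. lra.
Qed.

Lemma conv_ray u (x : C) (t : R) (l : C) : conv u (RtoC t * x)%C l ->
  PSeries (fun n => Re (u n * x ^ n)%C) t = Re l /\ PSeries (fun n => Im (u n * x ^ n)%C) t = Im l.
Proof.
  intros H.
  assert (Hn : forall n, (u n * (RtoC t * x) ^ n)%C = (RtoC (t ^ n) * (u n * x ^ n))%C).
  { intros n. rewrite Cpow_mult_l, RtoC_pow. ring. }
  assert (Hs : forall n, partial u (RtoC t * x) n
    = (sum_n (fun k => Re (u k * x ^ k)%C * t ^ k) n, sum_n (fun k => Im (u k * x ^ k)%C * t ^ k) n)).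
  { induction n as [|n IH].
    - rewrite partial_0, !sum_O. simpl. apply injective_projections; simpl; unfold Re, Im; simpl; ring.
    - rewrite partial_S, IH, !sum_Sn, Hn. unfold plus; simpl.
      apply injective_projections; simpl; unfold Re, Im; simpl; ring. }
  rewrite conv_iff in H.
  split; apply is_pseries_unique, is_pseries_R;
    apply (filterlim_locally_ball_norm (K := R_AbsRing) (U := R_NormedModule)); intros eps;
    destruct (H eps (cond_pos eps)) as [N HN]; exists N; intros n Hn'; specialize (HN n Hn');
    rewrite Hs in HN; (eapply Rle_lt_trans; [|exact HN]);
    revert HN; set (A := sum_n _ n); set (B := sum_n _ n); intros _.
  - exact (re_le_Cmod ((A, B) - l)%C).
  - exact (Rle_trans _ _ _ (Rmax_r _ _) (Rmax_Cmod ((A, B) - l)%C)).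
Qed.

Lemma CV_radius_ray u (x : C) M (part : C -> R) :
  (forall z, Rabs (part z) <= Cmod z) ->
  (forall n, Cmod (u n * x ^ n)%C <= M * (/ 2) ^ n) ->
  forall t, 0 <= t <= 1 -> Rbar_lt (Rabs t) (CV_radius (fun n => part (u n * x ^ n)%C)).
Proof.
  intros Hp H t Ht.
  apply (Rbar_lt_le_trans _ 2); [simpl; rewrite Rabs_right; lra|].
  apply CV_radius_bounded. exists M. intros n. rewrite Rabs_mult.
  rewrite (Rabs_right (2 ^ n)) by (apply Rle_ge, pow_le; lra).
  apply Rle_trans with (M * (/ 2) ^ n * 2 ^ n).
  - apply Rmult_le_compat_r; [apply pow_le; lra|]. eapply Rle_trans; [apply Hp|apply H].
  - right. rewrite Rmult_assoc, <- Rpow_mult_distr. replace (/ 2 * 2) with 1 by field. rewrite pow1. ring.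
Qed.

(** The coefficients of the derivative: those of [theta u], shifted. *)
Definition deriv u : fps := tl (euler u).

(** Restricted to a ray, the components of a complex power series are real power
    series, which may be differentiated termwise. *)
Lemma cder_ray u (x : C) M (psi : R -> C) (t : R) (d : C) :
  0 <= t <= 1 ->
  (forall n, Cmod (u n * x ^ n)%C <= M * (/ 2) ^ n) ->
  (forall s, -2 < s < 2 -> conv u (RtoC s * x)%C (psi s)) ->
  conv (deriv u) (RtoC t * x)%C d ->
  cder psi t (x * d)%C.
Proof.
  intros Ht Hb Hpsi Hd. apply (conv_cst_mul _ _ _ x) in Hd.
  apply conv_ray in Hd as [Hd1 Hd2].
  assert (Hl : locally t (fun s => -2 < s < 2)).
  { apply (open_and (fun s => -2 < s) (fun s => s < 2)); [apply open_gt|apply open_lt|lra]. }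
  assert (Hn : forall n, ((cst x * deriv u)%fps n * x ^ n)%C
    = (RtoC (INR (S n)) * (u (S n) * x ^ S n))%C).
  { intros n. rewrite fmul_cst. unfold deriv, tl, euler. simpl Cpow. ring. }
  split.
  - rewrite <- Hd1. apply (is_derive_ext_loc (PSeries (fun n => Re (u n * x ^ n)%C))).
    + apply (filter_imp (fun s => -2 < s < 2)); [|exact Hl].
      intros s Hs. exact (proj1 (conv_ray u x s _ (Hpsi s Hs))).
    + evar_last; [apply is_derive_PSeries, (CV_radius_ray u x M Re); [apply re_le_Cmod|exact Hb|exact Ht]|].
      apply PSeries_ext. intros n. rewrite Hn. unfold PS_derive. unfold Re at 2. simpl. unfold Re. simpl. ring.
  - rewrite <- Hd2. apply (is_derive_ext_loc (PSeries (fun n => Im (u n * x ^ n)%C))).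
    + apply (filter_imp (fun s => -2 < s < 2)); [|exact Hl].
      intros s Hs. exact (proj2 (conv_ray u x s _ (Hpsi s Hs))).
    + evar_last; [apply is_derive_PSeries, (CV_radius_ray u x M Im);
        [intros z; exact (Rle_trans _ _ _ (Rmax_r _ _) (Rmax_Cmod z))|exact Hb|exact Ht]|].
      apply PSeries_ext. intros n. rewrite Hn. unfold PS_derive. unfold Im at 2. simpl. unfold Im. simpl. ring.
Qed.

Lemma pw_bound k s n : Cmod (pw k s n) <= 1 * (Cmod k * (1 + Cmod s) + 1) ^ n.
Proof.
  pose proof (Cmod_ge_0 k). pose proof (Cmod_ge_0 s).
  assert (Hk : 0 <= Cmod k * (1 + Cmod s)) by (apply Rmult_le_pos; lra).
  rewrite Rmult_1_l. induction n as [|n IH]; [simpl; rewrite Cmod_1; lra|].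
  change (pw k s (S n)) with (pw k s n * (k * (INR n - s) / INR (S n)))%C.
  rewrite Cmod_mult. change ((Cmod k * (1 + Cmod s) + 1) ^ S n) with
    ((Cmod k * (1 + Cmod s) + 1) * (Cmod k * (1 + Cmod s) + 1) ^ n).
  rewrite Rmult_comm. apply Rmult_le_compat; try apply Cmod_ge_0; [|exact IH].
  rewrite Cmod_div by apply INR_S_neq_0. rewrite Cmod_mult.
  pose proof (pos_INR n).
  rewrite (Cmod_R (INR (S n))), Rabs_right by (apply Rle_ge, pos_INR).
  assert (Hns : Cmod (INR n - s)%C <= INR n + Cmod s).
  { unfold Cminus. eapply Rle_trans; [apply Cmod_triangle|]. rewrite Cmod_opp, Cmod_R, Rabs_right by lra. lra. }
  apply Rmult_le_reg_r with (INR (S n)); [rewrite S_INR; lra|].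
  unfold Rdiv. rewrite Rmult_assoc, Rinv_l, Rmult_1_r by (rewrite S_INR; lra).
  rewrite S_INR.
  assert (Cmod k * Cmod (INR n - s)%C <= Cmod k * (INR n + Cmod s)) by (apply Rmult_le_compat_l; lra).
  assert (Cmod k * (INR n + Cmod s) <= Cmod k * (1 + Cmod s) * (INR n + 1)).
  { rewrite Rmult_assoc. apply Rmult_le_compat_l; [lra|].
    assert (0 <= Cmod s * INR n) by now apply Rmult_le_pos. lra. }
  assert (0 <= INR n + 1) by lra. lra.
Qed.

Lemma deriv_bound u M rho : 0 < rho -> 0 <= M -> (forall n, Cmod (u n) <= M * rho ^ n) ->
  forall n, Cmod (deriv u n) <= M * rho * (2 * rho) ^ n.
Proof.
  intros Hr HM H n. unfold deriv, tl, euler. rewrite Cmod_mult, Cmod_R, Rabs_right by (apply Rle_ge, pos_INR).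
  assert (Hn : INR (S n) <= 2 ^ n).
  { induction n as [|n IH]; [simpl; lra|]. rewrite S_INR.
    assert (1 <= 2 ^ n) by (apply pow_R1_Rle; lra). simpl pow. lra. }
  apply Rle_trans with (2 ^ n * (M * rho ^ S n)).
  - apply Rmult_le_compat; [apply pos_INR|apply Cmod_ge_0|exact Hn|apply H].
  - right. rewrite Rpow_mult_distr. simpl. ring.
Qed.

Lemma pw_deriv k s : (deriv (pw k s) - cst k * (X * deriv (pw k s)))%fps = (cst 0 - cst (s * k) * pw k s)%fps.
Proof.
  apply fps_ext; intros n.
  pose proof (f_equal (fun w : fps => w (S n)) (pw_euler k s)) as E. cbv beta in E.
  rewrite one_sub_mul_S in E. unfold fopp in E. rewrite fmul_cst, fmul_X_S in E.
  unfold fsub. rewrite !fmul_cst.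
  transitivity (- (s * k * pw k s n))%C; [|destruct n; simpl cst; ring].
  rewrite <- E. destruct n as [|n]; [rewrite fmul_X_0; unfold deriv, tl, euler; simpl; ring|].
  rewrite fmul_X_S. reflexivity.
Qed.

(** Along the ray [t x], the product of the binomial series and of the principal
    power with the opposite exponent has derivative zero, and it is 1 at [t = 0]. *)
Lemma expansion_cpower k s : has_expansion (fun x => cpower (1 - k * x)%C s) (pw k s).
Proof.
  (* On [rho * Cmod x <= 1/4] the series converges along [r x] up to [r = 2], and
     [Cmod (k x) <= 1/4] keeps [1 - k x] in the right half-plane. *)
  set (rho := Cmod k * (1 + Cmod s) + 1).
  pose proof (Cmod_ge_0 k) as Hk. pose proof (Cmod_ge_0 s) as Hs.
  assert (Hks : Cmod k <= Cmod k * (1 + Cmod s)).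
  { rewrite <- (Rmult_1_r (Cmod k)) at 1. apply Rmult_le_compat_l; lra. }
  assert (Hrho : 1 <= rho) by (unfold rho; lra).
  apply near0_iff. exists (/ (4 * rho)); split; [apply Rinv_0_lt_compat; lra|]. intros x Hx.
  assert (Hrx : rho * Cmod x <= / 4).
  { replace (/ 4) with (rho * / (4 * rho)) by (field; lra). apply Rmult_le_compat_l; lra. }
  pose proof (Cmod_ge_0 x) as Hx0.
  assert (Hrx0 : 0 <= rho * Cmod x) by (apply Rmult_le_pos; lra).
  set (u := pw k s). assert (Hu : forall n, Cmod (u n) <= 1 * rho ^ n) by apply pw_bound.
  assert (Hconv : forall r, -2 < r < 2 -> conv u (RtoC r * x)%C (psum u (RtoC r * x)%C)).
  { intros r Hr. destruct (conv_exists u (RtoC r * x)%C 1 (rho * Cmod (RtoC r * x)%C)) as [l Hl].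
    - rewrite Cmod_mult, Cmod_R.
      assert (Rabs r <= 2) by (apply Rabs_le; lra). pose proof (Rabs_pos r).
      replace (rho * (Rabs r * Cmod x)) with (Rabs r * (rho * Cmod x)) by ring.
      split; [apply Rmult_le_pos; lra|].
      apply Rle_trans with (2 * (rho * Cmod x)); [apply Rmult_le_compat_r; lra|lra].
    - lra.
    - apply geo_term; [lra|exact Hu].
    - exact (psum_spec _ _ l Hl). }
  set (psi := fun r : R => psum u (RtoC r * x)%C).
  set (z := (- k * x)%C).
  assert (Hz : Cmod z <= / 4).
  { unfold z. rewrite Cmod_mult, Cmod_opp. apply Rle_trans with (rho * Cmod x); [|exact Hrx].
    apply Rmult_le_compat_r; unfold rho; lra. }
  set (L := fun r : R => Clog (1 + RtoC r * z)%C).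
  set (F := fun r : R => (psi r * Cexp (- s * L r))%C).
  assert (HF : F 0 = F 1).
  { apply cder_zero. intros t Ht.
    assert (Hre : 0 < 1 + t * Re z).
    { pose proof (re_le_Cmod z) as H1. apply Rabs_le_between in H1.
      assert (- / 4 <= t * Re z); [|lra].
      apply Rle_trans with (t * (- / 4)); [lra|]. apply Rmult_le_compat_l; lra. }
    assert (Hw : (1 + RtoC t * z)%C <> RtoC 0).
    { intros E. apply (f_equal Re) in E. unfold Re in *. simpl in E, Hre. lra. }
    assert (Htx : rho * Cmod (RtoC t * x)%C <= / 4).
    { rewrite Cmod_mult, Cmod_R, Rabs_right by lra.
      replace (rho * (t * Cmod x)) with (t * (rho * Cmod x)) by ring.
      apply Rle_trans with (1 * (rho * Cmod x)); [apply Rmult_le_compat_r; lra|lra]. }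
    assert (Htx0 : 0 <= rho * Cmod (RtoC t * x)%C) by (apply Rmult_le_pos; [lra|apply Cmod_ge_0]).
    destruct (conv_exists (deriv u) (RtoC t * x)%C (1 * rho) (2 * rho * Cmod (RtoC t * x)%C)) as [d Hd].
    - lra.
    - lra.
    - apply geo_term; [lra|]. apply deriv_bound; [lra|lra|exact Hu].
    - assert (Hpsi : cder psi t (x * d)%C).
      { apply (cder_ray u x 1); [exact Ht| |exact Hconv|exact Hd].
        intros n. eapply Rle_trans; [apply (geo_term 1 rho); [lra|exact Hu]|].
        rewrite !Rmult_1_l. apply pow_incr. lra. }
      assert (HL : cder L t (z / (1 + RtoC t * z))%C) by now apply cder_log_line.
      pose proof (cder_mul _ _ _ _ _ Hpsi (cder_exp _ _ _ (cder_scal (- s)%C _ _ _ HL))) as HD.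
      cbv beta in HD.
      assert (Ed : (d * (1 + RtoC t * z) = - (s * k) * psi t)%C).
      { assert (Hc : conv u (RtoC t * x)%C (psi t)) by (apply Hconv; lra).
        pose proof (conv_lin _ _ _ _ _ k Hd (conv_X _ _ _ Hd)) as C1.
        unfold u at 1 2 in C1. rewrite pw_deriv in C1. fold u in C1.
        assert (C2 : conv (cst 0 - cst (s * k) * u)%fps (RtoC t * x)%C (0 * psi t - s * k * psi t)%C).
        { apply conv_lin; [|exact Hc].
          replace (cst 0) with (cst 0 * u)%fps by ring. now apply conv_cst_mul. }
        pose proof (conv_unique _ _ _ _ C1 C2) as E.
        transitivity (d - k * (RtoC t * x * d))%C; [unfold z; ring|]. rewrite E. ring. }
      assert (Ed' : (x * d = s * z / (1 + RtoC t * z) * psi t)%C).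
      { transitivity (x * (d * (1 + RtoC t * z)) / (1 + RtoC t * z))%C; [field; exact Hw|].
        rewrite Ed. unfold z. field. exact Hw. }
      rewrite Ed' in HD.
      match type of HD with cder _ _ ?l => replace l with (RtoC 0) in HD by (field; exact Hw) end.
      exact HD. }
  unfold F in HF.
  assert (E0 : psi 0 = RtoC 1).
  { assert (Hc : conv u (RtoC 0 * x)%C (psi 0)) by (apply Hconv; lra).
    replace (RtoC 0 * x)%C with (RtoC 0) in Hc by ring.
    exact (conv_unique _ _ _ _ Hc (is_pseries_0 (K := C_AbsRing) (V := C_NormedModule) u)). }
  assert (EL : L 0 = RtoC 0).
  { unfold L. replace (1 + RtoC 0 * z)%C with (RtoC 1) by ring. apply Clog_1. }
  rewrite E0, EL in HF. replace (- s * 0)%C with (RtoC 0) in HF by ring. rewrite Cexp_0 in HF.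
  assert (EL1 : L 1 = Clog (1 - k * x)%C) by (unfold L, z; f_equal; ring).
  assert (E1 : psi 1 = cpower (1 - k * x)%C s).
  { unfold cpower. rewrite <- EL1.
    transitivity (psi 1 * Cexp (- s * L 1) * Cexp (s * L 1))%C.
    - rewrite <- Cmult_assoc, <- Cexp_add. replace (- s * L 1 + s * L 1)%C with (RtoC 0) by ring.
      rewrite Cexp_0. ring.
    - rewrite <- HF. ring. }
  rewrite <- E1. replace x with (RtoC 1 * x)%C at 1 by ring. apply Hconv. lra.
Qed.

(** * Coordinates and the operators on germs *)

Open Scope C_scope.

Lemma conv_one (x : C) : conv (cst 1) x (RtoC 1).
Proof.
  apply conv_iff. intros eps Heps. exists O. intros n _.
  replace (partial (cst 1) x n) with (RtoC 1).
  - replace (1 - 1) with (RtoC 0) by ring. now rewrite Cmod_0.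
  - symmetry. induction n as [|n IHn]; [apply partial_0|]. rewrite partial_S, IHn. simpl. ring.
Qed.

Lemma expansion_const k : has_expansion (fun _ => k) (cst k).
Proof.
  apply near0_iff. exists 1%R; split; [lra|]. intros x _.
  replace (cst k) with (cst k * cst 1)%fps by ring. replace k with (k * 1) at 2 by ring.
  apply conv_cst_mul, conv_one.
Qed.

Lemma expansion_id : has_expansion (fun x => x) X.
Proof.
  apply near0_iff. exists 1%R; split; [lra|]. intros x _.
  replace X with (X * cst 1)%fps by ring. replace x with (x * 1) at 2 by ring.
  apply conv_X, conv_one.
Qed.

Lemma expansion_sub f g u v : has_expansion f u -> has_expansion g v ->
  has_expansion (fun x => f x - g x) (u - v)%fps.
Proof.
  intros Hf Hg. replace (u - v)%fps with (u - cst 1 * v)%fps by ring.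
  apply (expansion_ext _ (fun x => f x - 1 * g x)); [|now apply expansion_lin].
  apply near0_iff. exists 1%R; split; [lra|]. intros x _. ring.
Qed.

Lemma expansion_neq_0 f u : has_expansion f u -> f 0 <> 0 -> near0 (fun x => f x <> 0).
Proof.
  intros H H0. rewrite (expansion_0 f u H) in H0.
  destruct (expansion_lipschitz f u H) as (K & HK & HL).
  assert (Hm : (0 < Cmod (u O))%R) by now apply Cmod_gt_0.
  refine (near0_imp _ _ _ (near0_and _ _ HL (near0_disc (Cmod (u O) / (K + 1))%R _))).
  2: apply Rdiv_lt_0_compat; lra.
  intros x [H1 H2] E. rewrite E in H1. replace (0 - u O) with (- u O) in H1 by ring.
  rewrite Cmod_opp in H1. pose proof (Cmod_ge_0 x).
  apply (Rmult_lt_compat_l (K + 1)) in H2; [|lra].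
  replace ((K + 1) * (Cmod (u O) / (K + 1)))%R with (Cmod (u O)) in H2 by (field; lra).
  lra.
Qed.

Lemma near0_comp (P : C -> Prop) (f : C -> C) u : near0 P -> has_expansion f u -> f 0 = 0 -> near0 (fun x => P (f x)).
Proof.
  intros HP H H0. rewrite (expansion_0 f u H) in H0.
  destruct (expansion_lipschitz f u H) as (K & HK & HL).
  apply near0_iff in HP as (r & Hr & HP).
  refine (near0_imp _ _ _ (near0_and _ _ HL (near0_disc (r / (K + 1))%R _))).
  2: apply Rdiv_lt_0_compat; lra.
  intros x [H1 H2]. apply HP. rewrite H0 in H1. replace (f x - 0) with (f x) in H1 by ring.
  pose proof (Cmod_ge_0 x).
  apply (Rmult_lt_compat_l (K + 1)) in H2; [|lra].
  replace ((K + 1) * (r / (K + 1)))%R with r in H2 by (field; lra).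
  lra.
Qed.

Lemma expansion_one_sub k : has_expansion (fun x => 1 - k * x) (one_sub k).
Proof. apply expansion_lin; [apply expansion_const|apply expansion_id]. Qed.

(** The sum [S] of the geometric series satisfies [(1 - k x) S = 1]. *)
Lemma expansion_geom k : has_expansion (fun x => / (1 - k * x)) (geom k).
Proof.
  assert (Hs : has_expansion (psum (geom k)) (geom k)).
  { apply geo_expansion. exists 1%R, (Cmod k * (1 + Cmod (- (1))) + 1)%R.
    pose proof (Cmod_ge_0 k). pose proof (Cmod_ge_0 (- (1))).
    assert (0 <= Cmod k * (1 + Cmod (- (1))))%R by (apply Rmult_le_pos; lra).
    repeat split; [lra|lra|]. apply pw_bound. }
  pose proof (expansion_mul _ _ _ _ (expansion_one_sub k) Hs) as H.
  rewrite one_sub_geom in H.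
  refine (expansion_ext _ _ _ _ Hs).
  refine (near0_imp _ _ _ (expansion_germ_eq _ _ _ H (expansion_const 1))).
  intros x E. cbv beta in E.
  assert (Hne : 1 - k * x <> 0).
  { intros E0. rewrite E0 in E. apply (RtoC_neq 1 0); [lra|]. rewrite <- E. ring. }
  transitivity ((1 - k * x) * psum (geom k) x / (1 - k * x)); [rewrite E; field; exact Hne|field; exact Hne].
Qed.

Lemma analytic_const k : analytic0 (fun _ => k).
Proof. exists (cst k). apply expansion_const. Qed.
Lemma analytic_id : analytic0 (fun x => x).
Proof. exists X. apply expansion_id. Qed.
Lemma analytic_sub f g : analytic0 f -> analytic0 g -> analytic0 (fun x => f x - g x).
Proof. intros [u Hu] [v Hv]. exists (u - v)%fps. now apply expansion_sub. Qed.
Lemma analytic_mul f g : analytic0 f -> analytic0 g -> analytic0 (fun x => f x * g x).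
Proof. intros [u Hu] [v Hv]. exists (u * v)%fps. now apply expansion_mul. Qed.
Lemma analytic_comp g f : analytic0 g -> analytic0 f -> f 0 = 0 -> analytic0 (fun x => g (f x)).
Proof.
  intros [v Hv] [u Hu] H0. exists (comp u v). apply expansion_comp; [exact Hv|exact Hu|].
  now rewrite <- (expansion_0 f u Hu).
Qed.
Lemma analytic_add f g : analytic0 f -> analytic0 g -> analytic0 (fun x => f x + g x).
Proof.
  intros [u Hu] [v Hv]. exists (u - cst (- (1)) * v)%fps.
  apply (expansion_ext _ (fun x => f x - - (1) * g x)); [|now apply expansion_lin].
  apply near0_iff. exists 1%R; split; [lra|]. intros x _. ring.
Qed.
Lemma analytic_ext f g : (forall x, f x = g x) -> analytic0 g -> analytic0 f.
Proof. intros E. now rewrite (functional_extensionality _ _ E). Qed.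

Lemma analytic_inv f : analytic0 f -> f 0 <> 0 -> analytic0 (fun x => / f x).
Proof.
  intros Hf H0.
  apply (analytic_ext _ (fun x => / f 0 * / (1 - 1 * (1 - f x * / f 0)))).
  - intros x. destruct (Ceq_dec (f x) 0) as [E|E].
    + rewrite E. replace (1 - 1 * (1 - 0 * / f 0)) with (RtoC 0) by ring.
      replace (/ RtoC 0) with (RtoC 0); [ring|].
      apply injective_projections; simpl; unfold Rdiv; ring.
    + replace (1 - 1 * (1 - f x * / f 0)) with (f x * / f 0) by ring. field. now split.
  - apply analytic_mul; [apply analytic_const|].
    apply (analytic_comp (fun w : C => / (1 - 1 * w)) (fun x => 1 - f x * / f 0)).
    + exists (geom 1). apply expansion_geom.
    + apply analytic_sub; [apply analytic_const|]. apply analytic_mul; [exact Hf|apply analytic_const].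
    + field. exact H0.
Qed.

(** The branch of [(1 - z)^(1/2)] in which the inverses of the three substitutions
    are rational. *)
Definition root (z : C) : C := cpower (1 - z) (1 / 2).

Lemma expansion_cpower_one_sub s : has_expansion (fun z => cpower (1 - z) s) (pw 1 s).
Proof.
  replace (fun z => cpower (1 - z) s) with (fun z => cpower (1 - 1 * z) s); [apply expansion_cpower|].
  apply functional_extensionality; intros z. f_equal. ring.
Qed.

Lemma root_square : near0 (fun z => root z * root z = 1 - z).
Proof.
  pose proof (expansion_cpower_one_sub (1 / 2)) as H.
  pose proof (expansion_mul _ _ _ _ H H) as H2. rewrite pw_add in H2.
  replace (1 / 2 + 1 / 2) with (RtoC 1) in H2 by field. rewrite pw_1 in H2.
  refine (near0_imp _ _ _ (expansion_germ_eq _ _ _ H2 (expansion_one_sub 1))).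
  intros z E. cbv beta in E. unfold root. rewrite E. ring.
Qed.

Lemma root_analytic : analytic0 root.
Proof. exists (pw 1 (1 / 2)). apply expansion_cpower_one_sub. Qed.

Lemma root_0 : root 0 = 1.
Proof. exact (expansion_0 _ _ (expansion_cpower_one_sub (1 / 2))). Qed.

(** Of the two square roots of [1 - y], only one has value 1 at 0. *)
Lemma root_unique (w y : C -> C) : analytic0 w -> analytic0 y -> w 0 = 1 -> y 0 = 0 ->
  near0 (fun x => w x * w x = 1 - y x) -> near0 (fun x => root (y x) = w x).
Proof.
  intros [ws Hw] [ys Hy] Hw0 Hy0 Hww.
  pose proof (near0_comp _ y ys root_square Hy Hy0) as Hrr.
  assert (Hsum : analytic0 (fun x => root (y x) + w x)).
  { apply analytic_add; [|now exists ws].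
    apply analytic_comp; [apply root_analytic|now exists ys|exact Hy0]. }
  destruct Hsum as [ss Hs].
  assert (H0 : root (y 0) + w 0 <> 0).
  { rewrite Hy0, Hw0, root_0. replace (1 + 1) with (RtoC 2) by (apply injective_projections; simpl; ring).
    apply RtoC_neq. lra. }
  pose proof (expansion_neq_0 _ _ Hs H0) as Hne.
  refine (near0_imp _ _ _ (near0_and _ _ (near0_and _ _ Hrr Hww) Hne)).
  intros x [[E1 E2] E3]. cbv beta in *.
  transitivity ((root (y x) * root (y x) - w x * w x) / (root (y x) + w x) + w x).
  - field. exact E3.
  - rewrite E1, E2. field. exact E3.
Qed.

(** The last clause is what makes [pullback] meaningful. *)
Definition coordinate (y : C -> C) (ys : fps) : Prop :=
  has_expansion y ys /\ ys O = 0 /\ ys 1%nat <> 0 /\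
  forall f, analytic0 f -> exists g, analytic0 g /\ germ_eq f (g ∘ y).

Lemma coordinate_of_inverse (y h : C -> C) ys : has_expansion y ys -> ys O = 0 -> ys 1%nat <> 0 ->
  analytic0 h -> h 0 = 0 -> near0 (fun x => h (y x) = x) -> coordinate y ys.
Proof.
  intros Hy H0 H1 Hh Hh0 Hinv. repeat split; try assumption.
  intros f Hf. exists (fun z => f (h z)). split; [now apply analytic_comp|].
  refine (near0_imp _ _ _ Hinv). intros x E. unfold compose. now rewrite E.
Qed.

(** Hence the Taylor coefficients of every germ are those of some series substituted
    into [ys], and the identities on germs become identities on series. *)
Lemma pullback_expansion (y : C -> C) ys f : coordinate y ys -> analytic0 f ->
  exists v, has_expansion (pullback y f) v /\ has_expansion f (comp ys v).
Proof.
  intros (Hy & H0 & _ & Hex) Hf.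
  destruct (epsilon_spec (inhabits (fun _ => RtoC 0))
    (fun g => analytic0 g /\ germ_eq f (g ∘ y)) (Hex f Hf)) as [[v Hv] E].
  exists v. split; [exact Hv|].
  apply (expansion_ext _ _ _ E). now apply (expansion_comp (pullback y f) y v ys).
Qed.

Lemma hyp_geo a c u : ~ nonpos_int c -> geo u -> geo (hyp a c u).
Proof.
  intros Hc (M & rho & HM & Hrho & Hu).
  destruct (nonpos_int_isolated c) as (r & Hr & Hiso).
  set (B := (1 + Cmod (a - c) / r)%R).
  assert (HB0 : (0 <= Cmod (a - c) / r)%R) by (apply Rdiv_le_0_compat; [apply Cmod_ge_0|lra]).
  assert (Hratio : forall n, (Cmod (poch a n / poch c n) <= B ^ n)%R).
  { induction n as [|n IH].
    - simpl. rewrite Cmod_div by (apply RtoC_neq; lra). rewrite Cmod_1. lra.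
    - assert (Hcn : c + INR n <> 0).
      { intros E. apply Hc. exists n. transitivity (c + INR n - INR n); [ring|rewrite E; ring]. }
      replace (poch a (S n) / poch c (S n)) with ((a + INR n) / (c + INR n) * (poch a n / poch c n)).
      2:{ simpl. field. split; [exact Hcn|now apply poch_neq_0]. }
      rewrite Cmod_mult. simpl pow. apply Rmult_le_compat; try apply Cmod_ge_0; [|exact IH].
      replace ((a + INR n) / (c + INR n)) with (1 + (a - c) * / (c + INR n)) by (field; exact Hcn).
      eapply Rle_trans; [apply Cmod_triangle|]. rewrite Cmod_1, Cmod_mult, Cmod_inv by exact Hcn.
      unfold B. apply Rplus_le_compat_l. apply Rmult_le_compat_l; [apply Cmod_ge_0|].
      apply Rinv_le_contravar; [exact Hr|]. destruct (Hiso n) as [E|E]; [contradiction|exact E]. }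
  exists M, (rho * B)%R. repeat split; [exact HM|apply Rmult_lt_0_compat; unfold B; lra|].
  intros n. unfold hyp. rewrite Cmod_mult, Rpow_mult_distr, <- Rmult_assoc.
  apply Rmult_le_compat; try apply Cmod_ge_0; auto.
Qed.

Lemma hyper_expansion a c f u : ~ nonpos_int c -> has_expansion f u ->
  has_expansion (hyper a c f) (hyp a c u).
Proof.
  intros Hc Hf.
  assert (Hcoef : has_expansion f (coef f)) by
    exact (epsilon_spec (inhabits (fun _ => RtoC 0)) (has_expansion f) (ex_intro _ u Hf)).
  assert (E : coef f = u).
  { apply (expansion_unique f f); [|exact Hcoef|exact Hf].
    exact (near0_imp _ _ (fun _ _ => eq_refl) Hf). }
  unfold hyper. rewrite E. apply geo_expansion. apply hyp_geo; [exact Hc|].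
  now apply expansion_geo with f.
Qed.

Lemma hyper_in_expansion a c (y : C -> C) ys f v : coordinate y ys -> ~ nonpos_int c ->
  has_expansion f (comp ys v) -> has_expansion (hyper a c (pullback y f)) (hyp a c v).
Proof.
  intros Hy Hc Hf.
  destruct (pullback_expansion y ys f Hy) as (v' & Hv' & Hf'); [now eexists; exact Hf|].
  assert (E : v' = v).
  { destruct Hy as (_ & H0 & H1 & _). apply (comp_inj ys); [exact H0|exact H1|].
    apply (expansion_unique f f); [|exact Hf'|exact Hf].
    exact (near0_imp _ _ (fun _ _ => eq_refl) Hf). }
  subst v'. now apply hyper_expansion.
Qed.

(** The middle factor is itself a function of [y], so all three factors act on the
    series [v] in the coordinate [y]. *)
Lemma bridge_expansion a c beta (y : C -> C) ys f v : coordinate y ys -> ~ nonpos_int c -> ~ nonpos_int beta ->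
  has_expansion f (comp ys v) ->
  has_expansion
    ((hyper_in beta c y
       ∘ mul (fun x => cpower (1 - y x) (- ((c - a) / 2)))
       ∘ hyper_in a beta y) f) (comp ys (bridge a c beta v)).
Proof.
  intros Hy Hc Hb Hf.
  pose proof (hyper_in_expansion a beta y ys f v Hy Hb Hf) as H1.
  pose proof (expansion_mul _ _ _ _ (expansion_cpower_one_sub (- ((c - a) / 2))) H1) as H2.
  assert (Hys := Hy). destruct Hys as (Hye & H0 & _ & _).
  pose proof (expansion_comp _ _ _ _ H2 Hye H0) as H3.
  pose proof (hyper_in_expansion beta c y ys _ _ Hy Hc H3) as H4.
  pose proof (expansion_comp _ _ _ _ H4 Hye H0) as H5.
  replace (- ((c - a) / 2)) with ((a - c) / 2) in * by (field; apply RtoC_neq; lra).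
  exact H5.
Qed.

(** Here [(1 - y)^(1/2) = (1 - x) / (1 + x)]. *)
Lemma koebe_coordinate : coordinate (fun x => 4 * x / (1 + x) ^ 2) koebe_series.
Proof.
  assert (Hy : has_expansion (fun x => 4 * x / (1 + x) ^ 2) koebe_series).
  { apply (expansion_ext _ (fun x => 4 * (x * (/ (1 - - (1) * x) * / (1 - - (1) * x))))).
    - refine (near0_imp _ _ _ (expansion_neq_0 _ _ (expansion_one_sub (- (1))) _)).
      + intros x E. assert (1 + x <> 0) by (intros E'; apply E; rewrite <- E'; ring).
        replace (1 - - (1) * x) with (1 + x) by ring. simpl. field. assumption.
      + replace (1 - - (1) * 0) with (RtoC 1) by ring. apply RtoC_neq; lra.
    - unfold koebe_series. replace (RtoC (-1)) with (- RtoC 1) by (apply injective_projections; simpl; ring).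
      apply expansion_mul; [apply expansion_const|]. apply expansion_mul; [apply expansion_id|].
      apply expansion_mul; apply expansion_geom. }
  assert (H10 : 1 + 0 <> 0) by (replace (1 + 0) with (RtoC 1) by ring; apply RtoC_neq; lra).
  assert (Hid : analytic0 (fun x => 1 + x)).
  { apply analytic_add; [apply analytic_const|apply analytic_id]. }
  apply (coordinate_of_inverse _ (fun z => (1 - root z) * / (1 + root z))).
  - exact Hy.
  - exact koebe_series_0.
  - unfold koebe_series, geom. rewrite fmul_cst, fmul_X_S. simpl.
    replace (4 * (1 * 1)) with (RtoC 4) by ring. apply RtoC_neq; lra.
  - apply analytic_mul.
    + apply analytic_sub; [apply analytic_const|apply root_analytic].
    + apply analytic_inv.
      * apply analytic_add; [apply analytic_const|apply root_analytic].
      * rewrite root_0. replace (1 + 1) with (RtoC 2) by (apply injective_projections; simpl; ring).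
        apply RtoC_neq; lra.
  - rewrite root_0. ring.
  - assert (Hne : near0 (fun x => 1 + x <> 0)).
    { destruct Hid as [u Hu]. exact (expansion_neq_0 _ _ Hu H10). }
    assert (Hroot : near0 (fun x => root (4 * x / (1 + x) ^ 2) = (1 - x) * / (1 + x))).
    { apply (root_unique (fun x => (1 - x) * / (1 + x)) (fun x => 4 * x / (1 + x) ^ 2)).
      - apply analytic_mul; [apply analytic_sub; [apply analytic_const|apply analytic_id]|].
        now apply analytic_inv.
      - now exists koebe_series.
      - field.
      - unfold Cdiv. ring.
      - refine (near0_imp _ _ _ Hne). intros x E. simpl. field. exact E. }
    refine (near0_imp _ _ _ (near0_and _ _ Hne Hroot)). intros x [E1 E2]. rewrite E2.
    field. split; [exact E1|]. replace (1 + x + (1 - x)) with (RtoC 2) by (apply injective_projections; simpl; ring).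
    apply RtoC_neq; lra.
Qed.

(** * The three coordinates *)

Open Scope C_scope.

(** Here [(1 - y)^(1/2) = 1 - 2 x]. *)
Lemma logistic_coordinate : coordinate (fun x => 4 * x * (1 - x)) logistic_series.
Proof.
  assert (Hy : has_expansion (fun x => 4 * x * (1 - x)) logistic_series).
  { replace (fun x => 4 * x * (1 - x)) with (fun x => 4 * (x * (1 - 1 * x)))
      by (apply functional_extensionality; intros x; ring).
    apply expansion_mul; [apply expansion_const|].
    apply expansion_mul; [apply expansion_id|apply expansion_one_sub]. }
  apply (coordinate_of_inverse _ (fun z => (1 - root z) * (/ 2))).
  - exact Hy.
  - exact logistic_series_0.
  - unfold logistic_series. rewrite fmul_cst, fmul_X_S. unfold one_sub, fsub. simpl.
    replace (4 * (1 - 1 * 0)) with (RtoC 4) by ring. apply RtoC_neq; lra.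
  - apply analytic_mul; [|apply analytic_const].
    apply analytic_sub; [apply analytic_const|apply root_analytic].
  - rewrite root_0. ring.
  - assert (Hroot : near0 (fun x => root (4 * x * (1 - x)) = 1 - 2 * x)).
    { apply (root_unique (fun x => 1 - 2 * x) (fun x => 4 * x * (1 - x))).
      - exists (one_sub 2). apply expansion_one_sub.
      - now exists logistic_series.
      - ring.
      - ring.
      - apply near0_iff. exists 1%R; split; [lra|]. intros x _. ring. }
    refine (near0_imp _ _ _ Hroot). intros x E. rewrite E. field.
Qed.

(** Here [(1 - y)^(1/2) = 1 / (1 - 2 x)]. *)
Lemma pfaff_coordinate : coordinate (fun x => 4 * x * (x - 1) / (1 - 2 * x) ^ 2) pfaff_series.
Proof.
  assert (H10 : 1 - 2 * 0 <> 0) by (replace (1 - 2 * 0) with (RtoC 1) by ring; apply RtoC_neq; lra).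
  assert (Hne : near0 (fun x => 1 - 2 * x <> 0)) by exact (expansion_neq_0 _ _ (expansion_one_sub 2) H10).
  assert (Hinv : analytic0 (fun x => / (1 - 2 * x))) by (exists (geom 2); apply expansion_geom).
  assert (Hy : has_expansion (fun x => 4 * x * (x - 1) / (1 - 2 * x) ^ 2) pfaff_series).
  { apply (expansion_ext _ (fun x => 0 - 4 * (x * ((1 - 1 * x) * (/ (1 - 2 * x) * / (1 - 2 * x)))))).
    - refine (near0_imp _ _ _ Hne). intros x E. simpl. field. exact E.
    - unfold pfaff_series.
      replace (- (cst 4 * (X * (one_sub 1 * (geom 2 * geom 2)))))%fps
        with (cst 0 - cst 4 * (X * (one_sub 1 * (geom 2 * geom 2))))%fps by ring.
      apply expansion_sub; [apply expansion_const|].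
      apply expansion_mul; [apply expansion_const|]. apply expansion_mul; [apply expansion_id|].
      apply expansion_mul; [apply expansion_one_sub|]. apply expansion_mul; apply expansion_geom. }
  apply (coordinate_of_inverse _ (fun z => (1 - / root z) * (/ 2))).
  - exact Hy.
  - exact pfaff_series_0.
  - unfold pfaff_series, geom, fopp. rewrite fmul_cst, fmul_X_S. unfold one_sub, fsub. simpl.
    replace (- (4 * ((1 - 1 * 0) * (1 * 1)))) with (- RtoC 4) by ring.
    rewrite <- RtoC_opp. apply RtoC_neq; lra.
  - apply analytic_mul; [|apply analytic_const].
    apply analytic_sub; [apply analytic_const|]. apply analytic_inv; [apply root_analytic|].
    rewrite root_0. apply RtoC_neq; lra.
  - rewrite root_0. field.
  - assert (Hroot : near0 (fun x => root (4 * x * (x - 1) / (1 - 2 * x) ^ 2) = / (1 - 2 * x))).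
    { apply (root_unique (fun x => / (1 - 2 * x)) (fun x => 4 * x * (x - 1) / (1 - 2 * x) ^ 2)).
      - exact Hinv.
      - now exists pfaff_series.
      - replace (1 - 2 * 0) with (RtoC 1) by ring. field.
      - unfold Cdiv. ring.
      - refine (near0_imp _ _ _ Hne). intros x E. simpl. field. exact E. }
    refine (near0_imp _ _ _ (near0_and _ _ Hne Hroot)). intros x [E1 E2]. rewrite E2.
    field. exact E1.
Qed.

(** * The quadratic transformations *)

Lemma conjugated_hyper_expansion (P Q : C -> C) p q a c f u : ~ nonpos_int c ->
  has_expansion P p -> has_expansion Q q -> has_expansion f u ->
  has_expansion ((mul P ∘ hyper a c ∘ mul Q) f) (p * hyp a c (q * u))%fps.
Proof.
  intros Hc HP HQ Hf. apply (expansion_mul P); [exact HP|].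
  apply hyper_expansion; [exact Hc|]. now apply (expansion_mul Q).
Qed.

Lemma pw_opp_mul k s u : (pw k s * (pw k (- s) * u))%fps = u.
Proof.
  replace (pw k s * (pw k (- s) * u))%fps with ((pw k s * pw k (- s)) * u)%fps by ring.
  rewrite pw_add. replace (s + - s) with (RtoC 0) by ring. rewrite pw_0. ring.
Qed.

Lemma cpower_opp_mul (z s : C) : cpower z s * cpower z (- s) = 1.
Proof.
  unfold cpower. rewrite <- Cexp_add. replace (s * Clog z + - s * Clog z) with (RtoC 0) by ring.
  apply Cexp_0.
Qed.

Lemma koebe_identity a c beta : 2 * beta = a + c - 1 -> ~ nonpos_int c -> ~ nonpos_int beta ->
  let y := fun x : C => 4 * x / (1 + x) ^ 2 in
  op_eq
    (mul (fun x => cpower (1 + x) (2 * beta))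
       ∘ hyper a c
       ∘ mul (fun x => cpower (1 + x) (- (2 * beta))))
    (hyper_in beta c y
       ∘ mul (fun x => cpower (1 - y x) (- ((c - a) / 2)))
       ∘ hyper_in a beta y).
Proof.
  intros Hbeta Hc Hb y f Hf.
  destruct (pullback_expansion y koebe_series f koebe_coordinate Hf) as (v & _ & Hfv).
  apply (expansion_germ_eq _ _ (comp koebe_series (bridge a c beta v))).
  2: exact (bridge_expansion a c beta y koebe_series f v koebe_coordinate Hc Hb Hfv).
  assert (Hpw : forall s, has_expansion (fun x => cpower (1 + x) s) (pw (-1) s)).
  { intros s. replace (fun x => cpower (1 + x) s) with (fun x => cpower (1 - (-1) * x) s).
    - apply expansion_cpower.
    - apply functional_extensionality; intros x. f_equal. ring. }
  pose proof (conjugated_hyper_expansion _ _ _ _ a c f _ Hc (Hpw (2 * beta)) (Hpw (- (2 * beta))) Hfv) as H.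
  rewrite (formal_koebe_identity a c beta v Hbeta Hc Hb), pw_opp_mul in H. exact H.
Qed.

Lemma logistic_identity a c beta : 2 * beta = a + c - 1 -> ~ nonpos_int c -> ~ nonpos_int beta ->
  let y := fun x : C => 4 * x * (1 - x) in
  op_eq
    (mul (fun x => cpower (1 - x) (1 - c))
       ∘ hyper a c
       ∘ mul (fun x => cpower (1 - x) (a - 1)))
    (hyper_in beta c y
       ∘ mul (fun x => cpower (1 - y x) (- ((c - a) / 2)))
       ∘ hyper_in a beta y).
Proof.
  intros Hbeta Hc Hb y f Hf.
  destruct (pullback_expansion y logistic_series f logistic_coordinate Hf) as (v & _ & Hfv).
  apply (expansion_germ_eq _ _ (comp logistic_series (bridge a c beta v))).
  2: exact (bridge_expansion a c beta y logistic_series f v logistic_coordinate Hc Hb Hfv).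
  pose proof (conjugated_hyper_expansion _ _ _ _ a c f _ Hc
    (expansion_cpower_one_sub (1 - c)) (expansion_cpower_one_sub (a - 1)) Hfv) as H.
  rewrite (formal_logistic_identity a c beta v Hbeta Hc Hb) in H.
  replace (c - 1) with (- (1 - c)) in H by ring. rewrite pw_opp_mul in H. exact H.
Qed.

Lemma pfaff_identity a c beta : 2 * beta = a + c - 1 -> ~ nonpos_int c -> ~ nonpos_int beta ->
  let y := fun x : C => 4 * x * (x - 1) / (1 - 2 * x) ^ 2 in
  op_eq
    (mul (fun x => cpower (1 - x) (1 - c))
       ∘ hyper a c
       ∘ mul (fun x => cpower (1 - x) (a - 1)))
    (mul (fun x => cpower (1 - y x) beta)
       ∘ hyper_in beta c y
       ∘ mul (fun x => cpower (1 - y x) (- ((c - a) / 2)))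
       ∘ hyper_in a beta y
       ∘ mul (fun x => cpower (1 - y x) (- beta))).
Proof.
  intros Hbeta Hc Hb y f Hf.
  assert (Hy : has_expansion y pfaff_series) by exact (proj1 pfaff_coordinate).
  assert (Hpw : forall s, has_expansion (fun x => cpower (1 - y x) s) (pfaff_factor s)).
  { intros s. apply (expansion_comp (fun z => cpower (1 - z) s) y);
      [apply expansion_cpower_one_sub|exact Hy|exact pfaff_series_0]. }
  set (f' := mul (fun x => cpower (1 - y x) (- beta)) f).
  assert (Hf' : analytic0 f').
  { apply analytic_mul; [eexists; apply Hpw|exact Hf]. }
  destruct (pullback_expansion y pfaff_series f' pfaff_coordinate Hf') as (v & _ & Hv).
  assert (Hfv : has_expansion f (pfaff_factor beta * comp pfaff_series v)%fps).
  { apply (expansion_ext _ (fun x => cpower (1 - y x) beta * f' x)).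
    - apply near0_iff. exists 1%R; split; [lra|]. intros x _. unfold f', mul.
      rewrite Cmult_assoc, cpower_opp_mul. ring.
    - now apply expansion_mul. }
  apply (expansion_germ_eq _ _ (pfaff_factor beta * comp pfaff_series (bridge a c beta v))%fps).
  - pose proof (conjugated_hyper_expansion _ _ _ _ a c f _ Hc
      (expansion_cpower_one_sub (1 - c)) (expansion_cpower_one_sub (a - 1)) Hfv) as H.
    rewrite (formal_pfaff_identity a c beta v Hbeta Hc Hb) in H.
    replace (c - 1) with (- (1 - c)) in H by ring. rewrite pw_opp_mul in H. exact H.
  - apply (expansion_mul (fun x => cpower (1 - y x) beta)); [apply Hpw|].
    exact (bridge_expansion a c beta y pfaff_series f' v pfaff_coordinate Hc Hb Hv).
Qed.

Theorem proposition10 :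
  forall a c beta : C,
    beta = (a + c - 1) / 2 ->
    ~ nonpos_int c ->
    ~ nonpos_int beta ->
    (let y := fun x : C => 4 * x / (1 + x) ^ 2 in
     op_eq
       (mul (fun x => cpower (1 + x) (2 * beta))
          ∘ hyper a c
          ∘ mul (fun x => cpower (1 + x) (- (2 * beta))))
       (hyper_in beta c y
          ∘ mul (fun x => cpower (1 - y x) (- ((c - a) / 2)))
          ∘ hyper_in a beta y))
    /\
    (let y := fun x : C => 4 * x * (1 - x) in
     op_eq
       (mul (fun x => cpower (1 - x) (1 - c))
          ∘ hyper a c
          ∘ mul (fun x => cpower (1 - x) (a - 1)))
       (hyper_in beta c y
          ∘ mul (fun x => cpower (1 - y x) (- ((c - a) / 2)))
          ∘ hyper_in a beta y))
    /\
    (let y := fun x : C => 4 * x * (x - 1) / (1 - 2 * x) ^ 2 in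
     op_eq
       (mul (fun x => cpower (1 - x) (1 - c))
          ∘ hyper a c
          ∘ mul (fun x => cpower (1 - x) (a - 1)))
       (mul (fun x => cpower (1 - y x) beta)
          ∘ hyper_in beta c y
          ∘ mul (fun x => cpower (1 - y x) (- ((c - a) / 2)))
          ∘ hyper_in a beta y
          ∘ mul (fun x => cpower (1 - y x) (- beta)))).
Proof.
  intros a c beta Hbeta Hc Hb.
  assert (E : 2 * beta = a + c - 1) by (rewrite Hbeta; field; apply RtoC_neq; lra).
  split; [|split].
  - now apply koebe_identity.
  - now apply logistic_identity.
  - now apply pfaff_identity.
Qed.
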